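(* Let $(M,H,K)$ be a nested principal bundle and let $g$ be a Riemannian metric on $M$ that is invariant under the action of $H$ and such that the bilinear form $\mathbb{I}^H_m$ on the Lie algebra of $H$ does not depend on $m\in M$. Let $\mathscr{D}_H\subset TM$ be the $g$-orthogonal complement of $\ker d\pi_H$ with metric $g_{\mathscr{D}_H}=g|_{\mathscr{D}_H}$, and let $\mathscr{D}=d\pi_K(\mathscr{D}_H)\subset T(M/K)$ with metric $g_{\mathscr{D}}=g_{M/K}|_{\mathscr{D}}$. Let $(n,\mu)\in T^*(M/K)$, and consider $m\in M$ with $n=\pi_K(m)$ and $\pi_K^*\mu=\lambda\in T^*_mM$. If the map $\pi_K^*\colon T^*(M/K)\to T^*M$ is a symplectomorphism (in the sense specified in the context), then, for all sufficiently small $t>0$, $$\pi_K\big(\gamma_{\mathscr{D}_H}^{sR}(t;m,\lambda)\big)=\gamma_{\mathscr{D}}^{sR}(t;n,\mu).$$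
   Context: All manifolds and Lie groups are assumed to be connected. A submersion $\pi_H\colon M\to N$ is a principal $H$-bundle if the Lie group $H$ acts on $M$ from the right, freely and transitively on each fiber; then $N\cong M/H$. Let $K<H$ be a closed Lie subgroup. The triplet $(M,H,K)$ is a nested principal bundle if $\pi_H\colon M\to M/H$ is a principal $H$-bundle and the restriction of the action to $K$ also gives a principal $K$-bundle $\pi_K\colon M\to M/K$. The induced submersion $\pi\colon M/K\to M/H$ satisfies $\pi\circ\pi_K=\pi_H$. Let $\mathfrak{h}$ be the Lie algebra of $H$. For $\xi\in\mathfrak{h}$ put $\sigma_m(\xi)=\frac{d}{dt}\big|_{t=0}m.\exp_H(t\xi)$, and define $\mathbb{I}^H_m(\xi,\eta)=g(\sigma_m(\xi),\sigma_m(\eta))$ for $m\in M$, $\xi,\eta\in\mathfrak{h}$. Let $\mathscr{D}_K\subset TM$ be the $g$-orthogonal complement of $\ker d\pi_K$. The Riemannian metric $g_{M/K}$ on $M/K$ is defined by $g(v,w)=g_{M/K}(d_m\pi_K(v),d_m\pi_K(w))$ for $v,w\in(\mathscr{D}_K)_m$, $m\in M$. Given a smooth subbundle $D\subset TX$ of the tangent bundle of a manifold $X$ with a fiberwise metric $g_D$ on $D$, the map $\sharp^{g_D}\colon T^*X\to TX$ sends $\lambda\in T_x^*X$ to the unique vector $\sharp^{g_D}(\lambda)\in D_x$ with $\lambda(w)=g_D(\sharp^{g_D}(\lambda),w)$ for all $w\in D_x$. The cometric is $g_D^*(\lambda,\mu)=g_D(\sharp^{g_D}(\lambda),\sharp^{g_D}(\mu))$,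 and the associated Hamiltonian is $\mathbf{H}^D(x,\lambda)=\frac12g_D^*(\lambda,\lambda)$ on $T^*X$. Its Hamiltonian vector field $\overrightarrow{\mathbf{H}}^D$ with respect to the canonical symplectic form $\omega_X$ on $T^*X$ is defined by $\omega_X(\overrightarrow{\mathbf{H}}^D,\cdot)=d\mathbf{H}^D$. With $\Pi_X\colon T^*X\to X$ the bundle projection, the sub-Riemannian geodesic starting at $x$ with covector $\lambda\in T_x^*X$ is $\gamma_D^{sR}(t;x,\lambda)=\big(\Pi_X\circ e^{t\overrightarrow{\mathbf{H}}^D}\big)(x,\lambda)$, for $t>0$ sufficiently small. This is applied to $(X,D,g_D)=(M,\mathscr{D}_H,g_{\mathscr{D}_H})$ and to $(X,D,g_D)=(M/K,\mathscr{D},g_{\mathscr{D}})$. The map $\pi_K^*$ is defined by $\pi_K^*(\lambda)(v)=\lambda(d_{m}\pi_K(v))$ for $m\in M$, $v\in T_mM$, $\lambda\in T^*_{\pi_K(m)}(M/K)$. When regarded as a map $T^*(M/K)\to T^*M$, it is a smooth map assigning to each $(n',\mu')$ a point $(m',\mu'\circ d_{m'}\pi_K)$ of $T^*M$ with $\pi_K(m')=n'$, and $(m,\lambda)$ is the image of $(n,\mu)$. ''Symplectomorphism'' means that $\omega_{M/K}(\alpha,\beta)=\omega_M\big(d\pi_K^*(\alpha),d\pi_K^*(\beta)\big)$ for all $\alpha,\beta$ tangent to $T^*(M/K)$ at a common point, where $\omega_M$ and $\omega_{M/K}$ are the canonical symplectic forms on $T^*M$ and $T^*(M/K)$. *)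

(* Defs.v *)
From HB Require Import structures.
From mathcomp Require Import all_boot all_order all_algebra.
From mathcomp Require Import boolp classical_sets functions reals topology.
From mathcomp Require Import normedtype derive.

Set Implicit Arguments.
Unset Strict Implicit.
Unset Printing Implicit Defensive.

Import Order.TTheory GRing.Theory Num.Theory.
Import numFieldNormedType.Exports.

Local Open Scope classical_set_scope.
Local Open Scope ring_scope.

(* [U] is meant to be open.  [Ck_on k.+1] asks for Frechet differentiability  *)
(* on [U] together with [Ck_on k] for every directional derivative; in finite *)
(* dimension this is the usual class C^k.                                     *)
Fixpoint Ck_on {R : realType} {V W : normedModType R} (k : nat)
    (U : set V) (f : V -> W) : Prop :=
  match k with
  | 0 => forall x, U x -> {for x, continuous f}
  | k'.+1 => (forall x, U x -> differentiable f x) /\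
             (forall v, Ck_on k' U (fun x => 'd f x v))
  end.

Definition smooth_on {R : realType} {V W : normedModType R}
    (U : set V) (f : V -> W) : Prop := forall k, Ck_on k U f.

(* A set with a family of charts indexed by its points: [chart x0] is the     *)
(* preferred chart around [x0], with domain [cdom x0] and inverse [cinv x0]   *)
(* (the values outside the domain, resp. the image, are irrelevant).  The     *)
(* axioms are in [is_manifold], so that products and cotangent bundles are    *)
(* plain data.                                                                *)
Record charted (R : realType) := Charted {
  carrier :> Type;
  mdim : nat;
  cdom : carrier -> set carrier;
  chart : carrier -> carrier -> 'rV[R]_mdim;
  cinv : carrier -> 'rV[R]_mdim -> carrier
}.

Section Manifolds.
Context {R : realType}.
Implicit Types X Y : charted R.

(* The topology is the one generated by the charts.                           *)
Definition chart_open X (U : set X) : Prop :=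
  forall x0 : X, open (chart x0 @` (cdom x0 `&` U)).

(* The openness clause encodes the continuity of [F].                         *)
Definition smooth X Y (F : X -> Y) : Prop :=
  forall (x0 : X) (y0 : Y),
    let U := chart x0 @` (cdom x0 `&` F @^-1` cdom y0) in
    open U /\ smooth_on U (chart y0 \o F \o cinv x0).

(* [smooth id] says that the chart images are open and that all changes of    *)
(* charts are smooth with open domains.  A countable subatlas amounts to      *)
(* second countability.                                                       *)
Record is_manifold X : Prop := IsManifold {
  mfd_mem : forall x : X, cdom x x;
  mfd_chartK : forall x0 x : X, cdom x0 x -> cinv x0 (chart x0 x) = x;
  mfd_compat : smooth (fun x : X => x);
  mfd_hausdorff : forall x y : X, x <> y ->
    exists U V : set X, [/\ chart_open U, chart_open V, U x, V y
                          & U `&` V = set0];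
  mfd_countable : exists s : nat -> X, forall x : X, exists k, cdom (s k) x;
  mfd_connected : forall U : set X,
    chart_open U -> chart_open (~` U) -> U !=set0 -> U = setT
}.

Definition product X Y : charted R :=
  @Charted R (X * Y)%type (mdim X + mdim Y)
    (fun p q => cdom p.1 q.1 /\ cdom p.2 q.2)
    (fun p q => row_mx (chart p.1 q.1) (chart p.2 q.2))
    (fun p u => (cinv p.1 (lsubmx u), cinv p.2 (rsubmx u))).

(* The tangent space T_x X is identified with row vectors, and T*_x X with    *)
(* column vectors, through the preferred chart at [x]; the pairing of a       *)
(* covector with a vector [v] is [v *m lam].  The differential                *)
(* d_x F : T_x X -> T_(F x) Y is then [fun v => v *m tmap F x], and its       *)
(* transpose mu |-> mu o d_x F is [fun mu => tmap F x *m mu].                 *)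
Notation tangent X := 'rV[R]_(mdim X).
Notation covector X := 'cV[R]_(mdim X).

Definition pairing X (lam : covector X) (v : tangent X) : R :=
  (v *m lam) ord0 ord0.

Definition tmap X Y (F : X -> Y) (x : X) : 'M[R]_(mdim X, mdim Y) :=
  'J (chart (F x) \o F \o cinv x) (chart x x).

(* Its rows are the coordinate vectors at [x] of the chart [chart x0],        *)
(* expressed in T_x X.                                                        *)
Definition frame X (x0 x : X) : 'M[R]_(mdim X) :=
  'J (chart x \o cinv x0) (chart x0 x).

Definition has_velocity X (c : R -> X) (t : R) (v : tangent X) : Prop :=
  (\forall s \near t, cdom (c t) (c s)) /\
  is_derive t (1 : R) (chart (c t) \o c) v.

(* Each chart of [X] induces the chart (q, p) of T*X, where p lists the       *)
(* values of the covector on the coordinate vectors.                          *)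
Definition cotangent X : charted R :=
  @Charted R (X * covector X)%type (mdim X + mdim X)
    (fun z0 z => cdom z0.1 z.1)
    (fun z0 z => row_mx (chart z0.1 z.1) (frame z0.1 z.1 *m z.2)^T)
    (fun z0 u => let x := cinv z0.1 (lsubmx u) in
                 (x, invmx (frame z0.1 x) *m (rsubmx u)^T)).

(* The preferred chart at [z] is a canonical chart (q, p), in which the       *)
(* canonical symplectic form is the sum of the dq_i /\ dp_i.                  *)
Definition canonical_symplectic X (z : cotangent X)
    (a b : tangent (cotangent X)) : R :=
  let a' : 'rV[R]_(mdim X + mdim X) := a in
  let b' : 'rV[R]_(mdim X + mdim X) := b in
  (lsubmx a' *m (rsubmx b')^T - rsubmx a' *m (lsubmx b')^T) ord0 ord0.

Definition hamiltonian_vf X (h : cotangent X -> R) (z : cotangent X) :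
    tangent (cotangent X) :=
  xget 0 [set V : tangent (cotangent X) | forall W : tangent (cotangent X),
    canonical_symplectic z V W = 'd (h \o cinv z) (chart z z) W].

(* The local flow t |-> e^(t V)(x) as a function of [t]: some integral curve  *)
(* on a neighbourhood of 0.  Only its germ at [t = 0] is meaningful.          *)
Definition local_flow X (V : X -> tangent X) (x : X) : R -> X :=
  xget (fun=> x : {classic X})
    [set c : R -> {classic X} | c 0 = x /\
      exists2 e : R, 0 < e &
        forall t, `|t| < e -> @has_velocity X c t (V (c t))].

(* A Riemannian metric is given by its Gram matrices in the spaces T_x X.     *)
Definition inner X (g : X -> 'M[R]_(mdim X)) (x : X) (v w : tangent X) : R :=
  (v *m g x *m w^T) ord0 ord0.

Record riemannian X (g : X -> 'M[R]_(mdim X)) : Prop := Riemannian {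
  riem_sym : forall (x : X) (v w : tangent X), inner g x v w = inner g x w v;
  riem_pos : forall (x : X) (v : tangent X), v != 0 -> 0 < inner g x v v;
  riem_smooth : forall x0 : X, smooth_on (chart x0 @` cdom x0)
    (fun u => let x := cinv x0 u in
              frame x0 x *m g x *m (frame x0 x)^T)
}.

(* A sub-Riemannian metric on [D] is passed as a metric [g] on TX, of which   *)
(* only the restriction to [D] is used.                                       *)
Definition sharp X (D : X -> set (tangent X)) (g : X -> 'M[R]_(mdim X))
    (x : X) (lam : covector X) : tangent X :=
  xget 0 [set v | D x v /\ forall w, D x w -> pairing lam w = inner g x v w].

Definition cometric X (D : X -> set (tangent X)) (g : X -> 'M[R]_(mdim X))
    (x : X) (lam mu : covector X) : R :=
  inner g x (sharp D g x lam) (sharp D g x mu).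

Definition sR_hamiltonian X (D : X -> set (tangent X))
    (g : X -> 'M[R]_(mdim X)) (z : cotangent X) : R :=
  2^-1 * cometric D g z.1 z.2 z.2.

Definition sR_geodesic X (D : X -> set (tangent X)) (g : X -> 'M[R]_(mdim X))
    (x : X) (lam : covector X) (t : R) : X :=
  (@local_flow (cotangent X) (hamiltonian_vf (sR_hamiltonian D g))
     (x, lam) t).1.

(* The [g]-orthogonal complement of the kernel of dF.                         *)
Definition horizontal X Y (g : X -> 'M[R]_(mdim X)) (F : X -> Y) (x : X) :
    set (tangent X) :=
  [set v | forall w, w *m tmap F x = 0 -> inner g x v w = 0].

Definition pushforward X Y (F : X -> Y) (D : X -> set (tangent X)) (y : Y) :
    set (tangent Y) :=
  [set w | exists x v, [/\ F x = y, D x v & w = v *m tmap F x]].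

End Manifolds.


Record lie_group (R : realType) := LieGroup {
  lg_mfd :> charted R;
  lg_one : lg_mfd;
  lg_mul : lg_mfd -> lg_mfd -> lg_mfd;
  lg_inv : lg_mfd -> lg_mfd;
  lg_manifold : is_manifold lg_mfd;
  lg_mulA : associative lg_mul;
  lg_mul1g : left_id lg_one lg_mul;
  lg_mulVg : left_inverse lg_one lg_inv lg_mul;
  lg_mul_smooth : smooth (fun p : product lg_mfd lg_mfd => lg_mul p.1 p.2);
  lg_inv_smooth : smooth lg_inv
}.

Section Bundles.
Context {R : realType}.
Implicit Types (X : charted R) (H K : lie_group R).

(* exp xi = c 1 for the one-parameter subgroup [c] with velocity [xi] at 0;   *)
(* the Lie algebra is the tangent space at [lg_one H].                        *)
Definition lie_exp H (xi : 'rV[R]_(mdim H)) : H :=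
  xget (fun=> lg_one H : {classic H})
    [set c : R -> {classic H} |
      (forall s t, c (s + t) = lg_mul (c s : H) (c t)) /\
      @has_velocity R H c 0 xi] 1.

Record closed_lie_subgroup H K (iota : K -> H) : Prop := ClosedLieSubgroup {
  sub_morph : {morph iota : k l / lg_mul k l >-> lg_mul k l};
  sub_inj : injective iota;
  sub_smooth : smooth iota;
  sub_immersion : forall k, row_free (tmap iota k);
  sub_closed : chart_open (~` range iota)
}.

Record principal_bundle H (M N : charted R) (pi : M -> N)
    (act : M -> H -> M) : Prop := PrincipalBundle {
  pb_total : is_manifold M;
  pb_base : is_manifold N;
  pb_smooth : smooth pi;
  pb_surj : forall n : N, exists m, pi m = n;
  pb_submersion : forall m, row_full (tmap pi m);
  pb_act_smooth : smooth (fun p : product M H => act p.1 p.2);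
  pb_act1 : forall m, act m (lg_one H) = m;
  pb_actM : forall m h h', act (act m h) h' = act m (lg_mul h h');
  pb_free : forall m h, act m h = m -> h = lg_one H;
  pb_fiber : forall m m', pi m = pi m' <-> exists h, m' = act m h
}.

Record nested_principal_bundle H K (M NH NK : charted R) (iota : K -> H)
    (act : M -> H -> M) (piH : M -> NH) (piK : M -> NK) : Prop :=
  NestedPrincipalBundle {
    nested_sub : closed_lie_subgroup iota;
    nested_H : principal_bundle piH act;
    nested_K : principal_bundle piK (fun m (k : K) => act m (iota k))
  }.

Definition sigma H (M : charted R) (act : M -> H -> M) (m : M)
    (xi : 'rV[R]_(mdim H)) : 'rV[R]_(mdim M) :=
  'D_1 (fun t : R => chart m (act m (lie_exp (t *: xi)))) 0.

Definition orbit_form H (M : charted R) (act : M -> H -> M)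
    (g : M -> 'M[R]_(mdim M)) (m : M) (xi eta : 'rV[R]_(mdim H)) : R :=
  inner g m (sigma act m xi) (sigma act m eta).

Definition invariant_metric H (M : charted R) (act : M -> H -> M)
    (g : M -> 'M[R]_(mdim M)) : Prop :=
  forall (h : H) (m : M) (v w : 'rV[R]_(mdim M)),
    inner g (act m h) (v *m tmap (act^~ h) m) (w *m tmap (act^~ h) m)
    = inner g m v w.

(* [gN] is the metric on the base making [pi] a Riemannian submersion.        *)
Definition quotient_metric (M N : charted R) (pi : M -> N)
    (g : M -> 'M[R]_(mdim M)) (gN : N -> 'M[R]_(mdim N)) : Prop :=
  riemannian gN /\
  forall m v w, horizontal g pi m v -> horizontal g pi m w ->
    inner g m v w = inner gN (pi m) (v *m tmap pi m) (w *m tmap pi m).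

(* A smooth choice of pullbacks (n, mu) |-> (m, mu o d_m pi), pi m = n.       *)
Definition pullback_map (M N : charted R) (pi : M -> N)
    (F : cotangent N -> cotangent M) : Prop :=
  smooth F /\
  forall z : cotangent N,
    pi (F z).1 = z.1 /\ (F z).2 = tmap pi (F z).1 *m z.2.

Definition symplectic_map (X Y : charted R)
    (F : cotangent X -> cotangent Y) : Prop :=
  forall (z : cotangent X) (a b : 'rV[R]_(mdim (cotangent X))),
    canonical_symplectic z a b =
    canonical_symplectic (F z) (a *m tmap F z) (b *m tmap F z).

End Bundles.

(* Main.v *)
From HB Require Import structures.
From mathcomp Require Import all_boot all_order all_algebra.
From mathcomp Require Import boolp classical_sets functions reals topology.
From mathcomp Require Import normedtype landau sequences derive.
From mathcomp Require Import measure lebesgue_measure lebesgue_integral ftc.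
From mathcomp Require Import ring lra.
Require Import Defs.
Set Implicit Arguments.
Unset Strict Implicit.
Unset Printing Implicit Defensive.
Import Order.TTheory GRing.Theory Num.Theory.
Import numFieldNormedType.Exports.
Local Open Scope classical_set_scope.
Local Open Scope ring_scope.

(** The sub-Riemannian geodesics are the projections of two Hamiltonian flows,
    with Hamiltonians [hM] on T*M and [hN] on T*(M/K). Two facts make the geodesics
    correspond.

    First, pulling back covectors along [piK] intertwines the Hamiltonians:
    [hM (x, mu \o d_x piK) = hN (piK x, mu)]. The horizontal space of [piH] is
    orthogonal to the fibers of [piK], so [d_x piK] maps it isometrically onto a
    subspace of the tangent space of M/K. By invariance of the metric under [K] this
    subspace is the same for all [x] of a fiber, hence it is the distribution on M/K,
    and the sharp maps correspond ([sR_hamiltonian_pullback]).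

    Second, for any smooth map [pi] and any Hamiltonians intertwined in this way, the
    flow of [hM] issued from a pulled back covector projects to the flow of [hN]
    ([hamiltonian_flow_projection]). Take a curve [x] of base points in M and a curve
    [q] of covectors over [pi \o x] such that
    [x' = dhM/dp (x, q \o d_x pi)] and [q' = - dhN/dy (pi x, q)]. Differentiating the
    intertwining relation in both variables shows that [(pi x, q)] solves Hamilton's
    equations for [hN], and that [(x, q \o d_x pi)] solves those for [hM]; the second
    derivatives of [pi] that appear cancel by symmetry ([lift_flow]). Such a pair
    [(x, q)] exists because it solves an ordinary differential equation
    ([picard_existence]), and by uniqueness of solutions ([picard_uniqueness]) the
    two curves are the two flows.

    As integral curves on a manifold are defined through charts that move with the
    point, one also needs that Hamilton's equations keep their form under changes of
    canonical charts ([ham_transition]); this is [lift_flow] again, applied to a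
    transition map. The remaining work is regularity: the Hamiltonian of a horizontal
    distribution is of class C^2 because in charts it is given by an explicit rational
    formula ([C2ham_sR]). *)

(** * Functions of class C^k *)

Section CkGeneral.
Context {R : realType} {V W : normedModType R}.
Implicit Types (U : set V) (f g : V -> W).

Lemma Ck_on_cont k U f : Ck_on k U f -> forall x, U x -> {for x, continuous f}.
Proof. by case: k => [//|k] [d _] x Ux; exact/differentiable_continuous/d. Qed.

Lemma Ck_onS k U f : Ck_on k.+1 U f -> Ck_on k U f.
Proof.
elim: k f => [|k IH] f; first exact: Ck_on_cont.
by move=> [df Cf]; split => // v; exact/IH/Cf.
Qed.

Lemma Ck_on_sub k U U' f : U' `<=` U -> Ck_on k U f -> Ck_on k U' f.
Proof.
move=> sU; elim: k f => [f Cf x /sU/Cf//|k IH f [df Cf]].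
by split=> [x /sU/df//|v]; exact/IH/Cf.
Qed.

Lemma Ck_onSE k U f : Ck_on k.+1 U f <->
  (forall x, U x -> differentiable f x) /\ forall v, Ck_on k U (fun x => 'd f x v).
Proof. by []. Qed.

(** Regularity is a local property; this is what lets a function be treated through
    a different chart, hence a different formula, around each point. *)
Lemma Ck_on_local k U f :
  (forall x, U x -> exists2 U', U' x & Ck_on k U' f) -> Ck_on k U f.
Proof.
elim: k f => [|k IH] f H.
  by move=> x /H[U' U'x]; exact.
split=> [x /H[U' U'x [+ _]]|v]; first exact.
by apply: IH => x /H[U' U'x /Ck_onSE[_ Cf]]; exists U'.
Qed.

(** The definition of the differential through Landau symbols, in epsilon form. *)
Lemma diffP_eps f x (L : {linear V -> W}) : continuous L ->
  (forall e, 0 < e -> \forall h \near 0, `|f (h + x) - f x - L h| <= e * `|h|) ->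
  differentiable f x /\ 'd f x = L :> (V -> W).
Proof.
move=> Lc H.
have E : f \o shift x = cst (f x) + L +o_ 0 id.
  apply/eqaddoP => e e0; have := H e e0; apply: filterS => h /=.
  by rewrite [(_ - _) h]/= opprD addrA.
have dE := diff_unique Lc E.
split=> //; apply/diff_locallyP; rewrite dE; split=> //.
Qed.

Lemma diff_eps f x : differentiable f x ->
  forall e, 0 < e -> \forall h \near 0, `|f (h + x) - f x - 'd f x h| <= e * `|h|.
Proof.
move=> /diff_locally /eqaddoP H e /H; apply: filterS => h /=.
by rewrite [(_ - _) h]/= opprD addrA.
Qed.

Lemma diff_near_eq f g x : {near x, f =1 g} -> differentiable f x ->
  differentiable g x /\ 'd g x = 'd f x :> (V -> W).
Proof.
move=> fg df; apply: diffP_eps; first exact: diff_continuous.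
move=> e e0; have := diff_eps df e0; have fx := nbhs_singleton fg.
have fg' : \forall h \near 0, f (h + x) = g (h + x).
  move/nbhs0P : fg; apply: filterS => h; by rewrite addrC.
by apply: filterS2 fg' => h E; rewrite E fx.
Qed.

(** Openness matters: the differentials of [f] and [g] agree on [U] only because
    the functions agree near each of its points. *)
Lemma Ck_on_ext k U f g : open U -> (forall x, U x -> f x = g x) ->
  Ck_on k U f -> Ck_on k U g.
Proof.
move=> oU; have nU x : U x -> (forall x, U x -> f x = g x) -> {near x, f =1 g}.
  by move=> Ux fg; near=> y; apply: fg; near: y; exact: open_nbhs_nbhs.
elim: k f g nU => [|k IH] f g nU fg.
  move=> Cf x Ux; rewrite /prop_for /continuous_at -fg//.
  by apply: cvg_trans (Cf x Ux); apply: near_eq_cvg; apply: nU.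
move=> /Ck_onSE[df Cf]; apply/Ck_onSE; split=> [x Ux|v].
  by have [] := diff_near_eq (nU x Ux fg) (df x Ux).
apply: (IH _ _ _ _ (Cf v)) => [x Ux fg'|x Ux]; last first.
  by have [_ E] := diff_near_eq (nU x Ux fg) (df x Ux); exact: (esym (congr1 (@^~ v) E)).
by near=> y; apply: fg'; near: y; exact: open_nbhs_nbhs.
Unshelve. all: by end_near. Qed.

Lemma Ck_on_cst k U (a : W) : Ck_on k U (fun=> a).
Proof.
elim: k a => [|k IH] a; first by move=> x _; exact: cvg_cst.
split=> [x _|v]; first exact: differentiable_cst.
rewrite (_ : (fun _ => _) = fun=> 0); first exact: IH.
by apply/funext => x; rewrite (diff_cst a x).
Qed.

Lemma Ck_on_lin k U (L : {linear V -> W}) : continuous L -> Ck_on k U L.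
Proof.
move=> Lc; case: k => [|k]; first by move=> x _; exact: Lc.
split=> [x _|v]; first exact: linear_differentiable.
rewrite (_ : (fun _ => _) = fun=> L v); first exact: Ck_on_cst.
by apply/funext => x; rewrite diff_lin.
Qed.

Lemma diffDv f g x v : differentiable f x -> differentiable g x ->
  'd (fun x => f x + g x) x v = 'd f x v + 'd g x v.
Proof. by move=> df dg; exact: (congr1 (@^~ v) (diffD df dg)). Qed.

Lemma Ck_onD k U f g : open U -> Ck_on k U f -> Ck_on k U g ->
  Ck_on k U (fun x => f x + g x).
Proof.
move=> oU; elim: k f g => [|k IH] f g.
  by move=> Cf Cg x Ux; apply: (@continuousD _ _ _ f g); [exact: Cf|exact: Cg].
move=> /Ck_onSE[df Cf] /Ck_onSE[dg Cg]; apply/Ck_onSE; split=> [x Ux|v].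
  by apply: differentiableD; [exact: df|exact: dg].
apply: Ck_on_ext oU _ (IH _ _ (Cf v) (Cg v)) => x Ux.
exact: (esym (diffDv v (df _ Ux) (dg _ Ux))).
Qed.

Lemma Ck_on_sum k U (I : Type) (r : seq I) (P : pred I) (F : I -> V -> W) :
  open U -> (forall i, P i -> Ck_on k U (F i)) ->
  Ck_on k U (fun x => \sum_(i <- r | P i) F i x).
Proof.
move=> oU CF; elim: r => [|i r IH].
  by under eq_fun do rewrite big_nil; exact: Ck_on_cst.
under eq_fun do rewrite big_cons; case Pi : (P i) => //.
by apply: Ck_onD => //; exact: CF.
Qed.
End CkGeneral.

Section CkScalar.
Context {R : realType} {V : normedModType R}.
Implicit Types (U : set V) (f g : V -> R).

Lemma diffMv f g x v : differentiable f x -> differentiable g x ->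
  'd (fun x => f x * g x) x v = f x * 'd g x v + g x * 'd f x v.
Proof. by move=> df dg; exact: (congr1 (@^~ v) (diffM df dg)). Qed.

Lemma diffVv f x v : differentiable f x -> f x != 0 ->
  'd (fun x => (f x)^-1) x v = - (f x) ^- 2 * 'd f x v.
Proof. by move=> df f0; exact: (congr1 (@^~ v) (diffV df f0)). Qed.

Lemma Ck_onM k U f g : open U -> Ck_on k U f -> Ck_on k U g ->
  Ck_on k U (fun x => f x * g x).
Proof.
move=> oU; elim: k f g => [|k IH] f g Cf Cg.
  by move=> x Ux; apply: (@continuousM _ _ f g); [exact: Cf|exact: Cg].
have [/Ck_onSE[df dCf] /Ck_onSE[dg dCg]] := (Cf, Cg).
apply/Ck_onSE; split=> [x Ux|v].
  by apply: differentiableM; [exact: df|exact: dg].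
apply: (@Ck_on_ext _ _ _ k U (fun x => f x * 'd g x v + g x * 'd f x v)) => //.
  by move=> x Ux; exact: (esym (diffMv v (df _ Ux) (dg _ Ux))).
by apply: Ck_onD => //; apply: IH => //; exact: Ck_onS.
Qed.

Lemma Ck_on_prod k U (I : Type) (r : seq I) (P : pred I) (F : I -> V -> R) :
  open U -> (forall i, P i -> Ck_on k U (F i)) ->
  Ck_on k U (fun x => \prod_(i <- r | P i) F i x).
Proof.
move=> oU CF; elim: r => [|i r IH].
  by under eq_fun do rewrite big_nil; exact: Ck_on_cst.
under eq_fun do rewrite big_cons; case Pi : (P i) => //.
by apply: Ck_onM => //; exact: CF.
Qed.

Lemma Ck_onV k U f : open U -> (forall x, U x -> f x != 0) ->
  Ck_on k U f -> Ck_on k U (fun x => (f x)^-1).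
Proof.
move=> oU f0; elim: k => [|k IH] Cf.
  by move=> x Ux; apply: (@continuousV _ _ f) => //; [exact: f0|exact: Cf].
have /Ck_onSE[df dCf] := Cf.
apply/Ck_onSE; split=> [x Ux|v].
  by apply: differentiableV; [exact: df|exact: f0].
apply: (@Ck_on_ext _ _ _ k U (fun x => (-1) * ((f x)^-1 * ((f x)^-1 * 'd f x v)))) => //.
  move=> x Ux; rewrite diffVv; [|exact: df|exact: f0].
  rewrite -exprVn; ring.
have CV := IH (Ck_onS Cf).
by apply: Ck_onM => //; [exact: Ck_on_cst|do 2! apply: Ck_onM => //].
Qed.

Lemma Ck_onZl {W : normedModType R} k U f (w : W) : open U ->
  Ck_on k U f -> Ck_on k U (fun x => f x *: w).
Proof.
move=> oU; elim: k f => [|k IH] f.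
  by move=> Cf x Ux; apply: continuousZr_tmp; exact: Cf.
move=> /Ck_onSE[df dCf]; apply/Ck_onSE; split=> [x Ux|v].
  by apply: differentiableZl; exact: df.
apply: Ck_on_ext (IH _ (dCf v)) => // x Ux.
by rewrite (congr1 (@^~ v) (diffZl w (df _ Ux))).
Qed.
End CkScalar.

Section CkMatrix.
Context {R : realType} {V : normedModType R} {m n : nat}.
Implicit Types (U : set V).

Definition entry i j (A : 'M[R]_(m, n)) : R := A i j.
Lemma entry_linear i j : linear (entry i j).
Proof. by move=> a A B; rewrite /entry !mxE. Qed.
HB.instance Definition _ i j := GRing.isLinear.Build R 'M[R]_(m, n) R _ (entry i j)
  (entry_linear i j).

Lemma diff_entry (f : V -> 'M[R]_(m, n)) x i j : differentiable f x ->
  differentiable (fun x => f x i j) x /\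
  forall v, 'd (fun x => f x i j) x v = ('d f x v) i j.
Proof.
move=> df.
have de : differentiable (entry i j) (f x).
  by apply: linear_differentiable; exact: coord_continuous.
have E : (fun x => f x i j) = entry i j \o f by [].
rewrite E; split; first exact: differentiable_comp.
by move=> v; rewrite diff_comp//= diff_lin//; exact: coord_continuous.
Qed.

Lemma Ck_on_entry k U (f : V -> 'M[R]_(m, n)) i j : open U ->
  Ck_on k U f -> Ck_on k U (fun x => f x i j).
Proof.
move=> oU; elim: k f => [|k IH] f.
  move=> Cf x Ux. exact: (continuous_comp (Cf x Ux) (@coord_continuous _ _ _ i j _)).
move=> /Ck_onSE[df dCf]; apply/Ck_onSE; split=> [x Ux|v].
  by have [] := diff_entry i j (df x Ux).
apply: Ck_on_ext (IH _ (dCf v)) => // x Ux.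
by have [_ ->] := diff_entry i j (df x Ux).
Qed.

Lemma Ck_on_mx k U (f : V -> 'M[R]_(m, n)) : open U ->
  (forall i j, Ck_on k U (fun x => f x i j)) -> Ck_on k U f.
Proof.
move=> oU Cf.
apply: (@Ck_on_ext _ _ _ k U (fun x => \sum_i \sum_j f x i j *: delta_mx i j)) => //.
  by move=> x _; rewrite -matrix_sum_delta.
by do 2!(apply: Ck_on_sum => // ? _); exact: Ck_onZl.
Qed.
End CkMatrix.

Section CkMatrixOps.
Context {R : realType} {V : normedModType R}.
Implicit Types (U : set V).

Lemma Ck_on_mulmx k U m n p (A : V -> 'M[R]_(m, n)) (B : V -> 'M[R]_(n, p)) :
  open U -> Ck_on k U A -> Ck_on k U B -> Ck_on k U (fun x => A x *m B x).
Proof.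
move=> oU CA CB; apply: Ck_on_mx => // i j; under eq_fun do rewrite mxE.
by apply: Ck_on_sum => // l _; apply: Ck_onM => //; exact: Ck_on_entry.
Qed.

Lemma Ck_on_trmx k U m n (A : V -> 'M[R]_(m, n)) :
  open U -> Ck_on k U A -> Ck_on k U (fun x => (A x)^T).
Proof.
move=> oU CA; apply: Ck_on_mx => // i j; under eq_fun do rewrite mxE.
exact: Ck_on_entry.
Qed.

Lemma Ck_on_row_mx k U m n p (A : V -> 'M[R]_(m, n)) (B : V -> 'M[R]_(m, p)) :
  open U -> Ck_on k U A -> Ck_on k U B -> Ck_on k U (fun x => row_mx (A x) (B x)).
Proof.
move=> oU CA CB; apply: Ck_on_mx => // i j; under eq_fun do rewrite mxE.
by case: (fintype.split j) => l; exact: Ck_on_entry.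
Qed.

Lemma Ck_on_lsubmx k U m n p (A : V -> 'M[R]_(m, n + p)) :
  open U -> Ck_on k U A -> Ck_on k U (fun x => lsubmx (A x)).
Proof.
move=> oU CA; apply: Ck_on_mx => // i j; under eq_fun do rewrite mxE.
exact: Ck_on_entry.
Qed.

Lemma Ck_on_rsubmx k U m n p (A : V -> 'M[R]_(m, n + p)) :
  open U -> Ck_on k U A -> Ck_on k U (fun x => rsubmx (A x)).
Proof.
move=> oU CA; apply: Ck_on_mx => // i j; under eq_fun do rewrite mxE.
exact: Ck_on_entry.
Qed.

Lemma Ck_on_det k U n (A : V -> 'M[R]_n) :
  open U -> Ck_on k U A -> Ck_on k U (fun x => \det (A x)).
Proof.
move=> oU CA; rewrite /determinant.
apply: Ck_on_sum => // s _; apply: Ck_onM => //; first exact: Ck_on_cst.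
by apply: Ck_on_prod => // i _; exact: Ck_on_entry.
Qed.

(** By Cramer's rule the entries of the inverse are rational functions of those of
    [A x], so regularity is inherited from sums, products and inverses of scalars. *)
Lemma Ck_on_invmx k U n (A : V -> 'M[R]_n) :
  open U -> (forall x, U x -> A x \in unitmx) ->
  Ck_on k U A -> Ck_on k U (fun x => invmx (A x)).
Proof.
move=> oU uA CA.
apply: (@Ck_on_ext _ _ _ k U (fun x => (\det (A x))^-1 *: \adj (A x))) => //.
  by move=> x /uA Ax; rewrite /invmx Ax.
apply: Ck_on_mx => // i j; under eq_fun do rewrite !mxE.
apply: Ck_onM => //.
  apply: Ck_onV => //; last exact: Ck_on_det.
  by move=> x /uA; rewrite unitmxE unitfE.
rewrite /cofactor; apply: Ck_onM => //; first exact: Ck_on_cst.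
apply: Ck_on_det => //; apply: Ck_on_mx => // a b; under eq_fun do rewrite !mxE.
exact: Ck_on_entry.
Qed.
End CkMatrixOps.

Section CkComp.
Context {R : realType}.

Lemma rV_linear_continuous n (W : normedModType R) (L : {linear 'rV[R]_n -> W}) :
  continuous L.
Proof.
have CL : Ck_on 0 setT (fun u => \sum_j (u : 'rV[R]_n) ord0 j *: L (delta_mx 0 j)).
  apply: Ck_on_sum => [|j _]; first exact: openT.
  apply: Ck_onZl; first exact: openT.
  by move=> x _; exact: coord_continuous.
move=> x; have := CL x I; rewrite /prop_for (_ : (fun u => _) = L)//.
apply/funext => u; rewrite [in RHS](row_sum_delta u) linear_sum.
by apply: eq_bigr => j _; rewrite linearZ.
Qed.

Lemma Ck_on_linrV k n (W : normedModType R) (L : {linear 'rV[R]_n -> W}) U :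
  Ck_on k U L.
Proof. exact: Ck_on_lin (@rV_linear_continuous _ _ L). Qed.

Lemma diff_compv (U V W : normedModType R) (f : U -> V) (g : V -> W) x v :
  differentiable f x -> differentiable g (f x) ->
  'd (g \o f) x v = 'd g (f x) ('d f x v).
Proof. by move=> df dg; exact: (congr1 (@^~ v) (diff_comp df dg)). Qed.

(** The chain rule evaluates ['d g] at a direction that varies with the point.
    Expanding this direction in the canonical basis of the intermediate row space
    reduces it to fixed directions, where the induction hypothesis applies. *)
Lemma Ck_on_comp (V : normedModType R) n (W : normedModType R) k (U : set V)
  (U' : set 'rV[R]_n) (f : V -> 'rV[R]_n) (g : 'rV[R]_n -> R) :
  open U -> (forall x, U x -> U' (f x)) -> Ck_on k U f -> Ck_on k U' g ->
  Ck_on k U (g \o f).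
Proof.
move=> oU fU; elim: k f g fU => [|k IH] f g fU Cf Cg.
  by move=> x Ux; apply: continuous_comp (Cf x Ux) (Cg _ (fU _ Ux)).
have [/Ck_onSE[df dCf] /Ck_onSE[dg dCg]] := (Cf, Cg).
apply/Ck_onSE; split=> [x Ux|v].
  by apply: differentiable_comp; [exact: df|exact/dg/fU].
apply: (@Ck_on_ext _ _ _ k U (fun x =>
  \sum_j ('d f x v) ord0 j * ((fun y => 'd g y (delta_mx 0 j)) \o f) x)) => //.
  move=> x Ux; rewrite (diff_compv v (df _ Ux) (dg _ (fU _ Ux)))/=.
  rewrite [in RHS](row_sum_delta ('d f x v)) linear_sum.
  by apply: eq_bigr => j _; rewrite linearZ.
apply: Ck_on_sum => // j _; apply: Ck_onM => //.
  exact: Ck_on_entry.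
by apply: IH => //; exact: Ck_onS.
Qed.

Lemma Ck_on_comp_mx (V : normedModType R) n k (U : set V) p q
  (U' : set 'rV[R]_n) (f : V -> 'rV[R]_n) (g : 'rV[R]_n -> 'M[R]_(p, q)) :
  open U -> open U' -> (forall x, U x -> U' (f x)) -> Ck_on k U f -> Ck_on k U' g ->
  Ck_on k U (g \o f).
Proof.
move=> oU oU' fU Cf Cg; apply: Ck_on_mx => // i j.
have := @Ck_on_comp _ _ R k _ _ _ (fun x => g x i j) oU fU Cf; apply.
exact: Ck_on_entry.
Qed.

Lemma jacobianE n p (f : 'rV[R]_n -> 'rV[R]_p) x v : v *m 'J f x = 'd f x v.
Proof. by rewrite /jacobian mul_rV_lin1. Qed.

Lemma Ck_on_jacobian n p k U (f : 'rV[R]_n -> 'rV[R]_p) : open U ->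
  Ck_on k.+1 U f -> Ck_on k U (jacobian f).
Proof.
move=> oU /Ck_onSE[_ Cf]; apply: Ck_on_mx => // i j.
rewrite /jacobian; under eq_fun do rewrite mxE.
exact: Ck_on_entry.
Qed.
End CkComp.

(** * Curves and mean values *)

Section Curves.
Context {R : realType}.

Lemma is_derive_comp (V W : normedModType R) (f : V -> W) (c : R -> V) t c' :
  is_derive t (1 : R) c c' -> differentiable f (c t) ->
  is_derive t (1 : R) (f \o c) ('d f (c t) c').
Proof.
move=> [dc <-] df.
have dc' : differentiable c t by apply/derivable1_diffP.
have dfc : differentiable (f \o c) t by exact: differentiable_comp.
apply: DeriveDef; first exact/derivable1_diffP.
by rewrite !deriveE//; exact: diff_compv.
Qed.

Lemma is_derive_mxP m n (M : R -> 'M[R]_(m, n)) t M' :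
  is_derive t (1 : R) M M' <->
  forall i j, is_derive t (1 : R) (fun s => M s i j) (M' i j).
Proof.
split=> [[dM <-] i j|H].
  have dMij := (derivable_mxP M t 1).1 dM.
  by apply: DeriveDef => //; rewrite derive_mx// mxE.
have dM : derivable M t 1 by apply/derivable_mxP => i j; have [] := H i j.
apply: DeriveDef => //; rewrite derive_mx//.
by apply/matrixP => i j; rewrite mxE; have [] := H i j.
Qed.

Lemma is_derive_mulmx m n p (A : R -> 'M[R]_(m, n)) (B : R -> 'M[R]_(n, p))
    t A' B' : is_derive t (1 : R) A A' -> is_derive t (1 : R) B B' ->
  is_derive t (1 : R) (fun s => A s *m B s) (A t *m B' + A' *m B t).
Proof.
move=> /is_derive_mxP dA /is_derive_mxP dB; apply/is_derive_mxP => i j.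
have -> : (fun s => (A s *m B s) i j) = \sum_k ((fun s => A s i k) * (fun s => B s k j)).
  by apply/funext => s; rewrite mxE fct_sumE.
have H := @is_derive_sum R R R n _ t 1 _ (fun k => is_deriveM (dA i k) (dB k j)).
apply: (is_derive_eq H).
rewrite !mxE -big_split/=; apply: eq_bigr => k _.
by rewrite /GRing.scale/= [B t k j * _]mulrC.
Qed.

Lemma is_derive_row_mx m n p (A : R -> 'M[R]_(m, n)) (B : R -> 'M[R]_(m, p))
    t A' B' : is_derive t (1 : R) A A' -> is_derive t (1 : R) B B' ->
  is_derive t (1 : R) (fun s => row_mx (A s) (B s)) (row_mx A' B').
Proof.
move=> /is_derive_mxP dA /is_derive_mxP dB; apply/is_derive_mxP => i j.
under eq_fun do rewrite mxE.
by rewrite mxE; case: (fintype.split j).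
Qed.

Lemma is_derive_lsubmx m n p (A : R -> 'M[R]_(m, n + p)) t A' :
  is_derive t (1 : R) A A' -> is_derive t (1 : R) (fun s => lsubmx (A s)) (lsubmx A').
Proof.
move=> /is_derive_mxP dA; apply/is_derive_mxP => i j; rewrite mxE.
by under eq_fun do rewrite mxE.
Qed.

Lemma is_derive_rsubmx m n p (A : R -> 'M[R]_(m, n + p)) t A' :
  is_derive t (1 : R) A A' -> is_derive t (1 : R) (fun s => rsubmx (A s)) (rsubmx A').
Proof.
move=> /is_derive_mxP dA; apply/is_derive_mxP => i j; rewrite mxE.
by under eq_fun do rewrite mxE.
Qed.

Lemma is_derive_trmx m n (A : R -> 'M[R]_(m, n)) t A' :
  is_derive t (1 : R) A A' -> is_derive t (1 : R) (fun s => (A s)^T) A'^T.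
Proof.
move=> /is_derive_mxP dA; apply/is_derive_mxP => i j; rewrite mxE.
by under eq_fun do rewrite mxE.
Qed.

Lemma is_derive_continuous (W : normedModType R) (c : R -> W) t c' :
  is_derive t (1 : R) c c' -> {for t, continuous c}.
Proof. by move=> [/derivable1_diffP/differentiable_continuous]. Qed.

Lemma normr_entry m n (A : 'M[R]_(m, n)) i j : `|A i j| <= `|A|.
Proof.
by rewrite [leRHS]/Num.Def.normr/= mx_normrE;
  exact: (le_bigmax _ (fun ij => `|A ij.1 ij.2|) (i, j)).
Qed.

Lemma normr_mx_le m n (A : 'M[R]_(m, n)) (C : R) :
  0 <= C -> (forall i j, `|A i j| <= C) -> `|A| <= C.
Proof.
by move=> C0 H; rewrite [leLHS]/Num.Def.normr/= mx_normrE;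
  apply: bigmax_le => // -[i j] _; exact: H.
Qed.

(** The mean value theorem holds entry by entry, and the norm is the maximum of
    the entries; so the vector-valued inequality holds without loss. *)
Lemma mean_value_le m n (u u' : R -> 'M[R]_(m, n)) (C a b : R) : a <= b ->
  (forall t : R, a <= t <= b -> is_derive t (1 : R) u (u' t)) ->
  (forall t : R, a <= t <= b -> `|u' t| <= C) -> `|u b - u a| <= C * (b - a).
Proof.
move=> ab du Cu.
have C0 : 0 <= C by apply: le_trans (Cu a _); rewrite ?lexx.
apply: normr_mx_le => [|i j]; first by rewrite mulr_ge0// subr_ge0.
have du' (t : R) : a <= t <= b -> is_derive t (1 : R) (fun s => u s i j) (u' t i j).
  by move=> /du/is_derive_mxP.
have [||c cab E] := @MVT_segment R (fun s => u s i j) (fun t => u' t i j) a b ab.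
- by move=> t; rewrite in_itv/= => /andP[at_ tb]; apply: du'; rewrite !ltW.
- apply: derivable_within_continuous => t; rewrite in_itv/= => tab.
  by have [] := du' _ tab.
rewrite !mxE E normrM (ger0_norm (_ : 0 <= b - a)) ?subr_ge0//.
rewrite ler_wpM2r ?subr_ge0//; apply: le_trans (Cu c _); first exact: normr_entry.
by move: cab; rewrite in_itv.
Qed.

(** The form used for estimates that are symmetric in time: [b] may lie on either
    side of [a]. *)
Lemma mean_value_center m n (u u' : R -> 'M[R]_(m, n)) (C a b : R) :
  (forall t : R, `|t - a| <= `|b - a| -> is_derive t (1 : R) u (u' t)) ->
  (forall t : R, `|t - a| <= `|b - a| -> `|u' t| <= C) ->
  `|u b - u a| <= C * `|b - a|.
Proof.
move=> du Cu.
have [ab|/ltW ba] := leP a b.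
  have H (t : R) : a <= t <= b -> `|t - a| <= `|b - a|.
    by move=> /andP[? ?]; rewrite !ger0_norm ?subr_ge0// lerD2r.
  by rewrite [X in _ * X]ger0_norm ?subr_ge0//; apply: mean_value_le => // t /H;
    [exact: du|exact: Cu].
have H (t : R) : b <= t <= a -> `|t - a| <= `|b - a|.
  by move=> /andP[? ?]; rewrite !ler0_norm ?subr_le0// lerN2 lerD2r.
rewrite distrC [X in _ * X]distrC [X in _ * X]ger0_norm ?subr_ge0//.
by apply: mean_value_le => // t /H; [exact: du|exact: Cu].
Qed.

Lemma is_derive_diff (W : normedModType R) (u : R -> W) (t : R) :
  differentiable u t -> is_derive t (1 : R) u ('d u t 1).
Proof. by move=> du; apply: DeriveDef; [exact/derivable1_diffP|exact: deriveE]. Qed.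

Lemma is_derive_eps (W : normedModType R) (u : R -> W) (t : R) (w : W) :
  (forall e : R, 0 < e -> \forall h \near (0 : R),
    `|u (h + t) - u t - h *: w| <= e * `|h|) ->
  is_derive t (1 : R) u w.
Proof.
move=> H.
have [ds sE] := is_diff_scalel (0 : R) w.
have sE' h : 'd ( *:%R^~ w) (0 : R) h = h *: w by exact: (congr1 (@^~ h) sE).
have [|du dE] := @diffP_eps R R W u t ('d ( *:%R^~ w) (0 : R)) (diff_continuous ds).
  by move=> e e0; apply: filterS (H e e0) => h; rewrite sE'.
exact: is_derive_eq (is_derive_diff du) (etrans (congr1 (@^~ (1 : R)) dE)
  (etrans (sE' 1) (scale1r w))).
Qed.

End Curves.

(** * Symmetry of second derivatives *)

Section Schwarz.
Context {R : realType} {V : normedModType R}.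

Lemma is_derive_line (a v : V) (s : R) :
  is_derive s (1 : R) (fun r : R => a + r *: v) v.
Proof.
have [ds dE] := is_diff_scalel s v.
have H : is_derive s (1 : R) (fun r : R => r *: v) v.
  apply: DeriveDef; first exact/derivable1_diffP.
  by rewrite deriveE//; have := congr1 (@^~ 1) dE; rewrite /= scale1r.
have : is_derive s (1 : R) (fun r : R => cst a r + r *: v) (0 + v).
  exact: is_deriveD (is_derive_cst a s (1 : R)) H.
by rewrite add0r.
Qed.

(** The mean value theorem turns the second difference of [f] into [t] times a
    difference of values of the function ['d f _ v], and differentiability of this
    function at the single point [x] identifies the leading term. *)
Lemma second_difference (U : set V) (f : V -> R) (x v w : V) : open U -> U x ->
  (forall y, U y -> differentiable f y) ->
  differentiable (fun y => 'd f y v) x ->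
  forall e : R, 0 < e -> \forall t \near 0^'+,
    `|f (x + t *: v + t *: w) - f (x + t *: v) - f (x + t *: w) + f x
      - t ^+ 2 * 'd (fun y => 'd f y v) x w| <= e * t ^+ 2.
Proof.
move=> oU Ux df dg e e0; set g := fun y => 'd f y v.
have C0 : 0 < 2 * `|v| + `|w| + 1 by rewrite ltr_wpDl// addr_ge0// mulr_ge0.
set C := 2 * `|v| + `|w| + 1 in C0.
have e'0 : 0 < e / C by rewrite divr_gt0.
have [d /= d0 dP] : exists2 d : R, 0 < d & forall h, `|h| < d ->
    U (x + h) /\ `|g (h + x) - g x - 'd g x h| <= e / C * `|h|.
  have H1 : \forall h \near (0 : V), U (x + h).
    by move: (open_nbhs_nbhs (conj oU Ux)) => /nbhs0P.
  have /nbhs_ballP[d d0 dP] : \forall h \near (0 : V), U (x + h) /\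
    `|g (h + x) - g x - 'd g x h| <= e / C * `|h|.
    by apply: filterS2 H1 (diff_eps dg e'0).
  exists d => // h hd; apply: dP; rewrite -ball_normE/= sub0r normrN//.
near=> t.
have t0 : 0 < t by [].
have tC : t * C < d.
  by rewrite -ltr_pdivlMr//; near: t; apply: nbhs_right_lt; rewrite divr_gt0.
have small s : 0 <= s <= t -> `|s *: v + t *: w| < d /\ `|s *: v| < d.
  move=> /andP[s0 st].
  have H1 : `|s *: v| <= t * `|v| by rewrite normrZ ger0_norm// ler_wpM2r.
  have H2 : `|t *: w| = t * `|w| by rewrite normrZ gtr0_norm.
  have := normr_ge0 v; have := normr_ge0 w => w0 v0.
  split; first by apply: le_lt_trans (ler_normD _ _) _; apply: le_lt_trans tC;
    rewrite H2 /C; nra.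
  by apply: le_lt_trans tC; rewrite /C; nra.
pose phi s := f (x + s *: v + t *: w) - f (x + s *: v).
have dline (a : V) s : differentiable f (a + s *: v) ->
    is_derive s (1 : R) (fun r : R => f (a + r *: v)) ('d f (a + s *: v) v).
  by move=> dfa; exact: is_derive_comp (is_derive_line a v s) dfa.
have dphi s : 0 <= s <= t -> is_derive s (1 : R) phi
    (g (x + s *: v + t *: w) - g (x + s *: v)).
  move=> st; have [s1 s2] := small _ st.
  have [U1 _] := dP _ s1; have [U2 _] := dP _ s2; rewrite addrA in U1.
  apply: is_deriveB; last exact/dline/df.
  have := dline (x + t *: w) s; rewrite addrAC => H.
  under eq_fun do rewrite addrAC.
  by apply: H; exact: df.
have [||xi xit E] := @MVT_segment R phi (fun s => g (x + s *: v + t *: w) - g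
  (x + s *: v)) 0 t (ltW t0).
- by move=> s; rewrite in_itv/= => /andP[s0 st]; apply: dphi; rewrite !ltW.
- apply: derivable_within_continuous => s; rewrite in_itv/= => st.
  by have [] := dphi _ st.
have {}xit : 0 <= xi <= t by move: xit; rewrite in_itv.
have -> : f (x + t *: v + t *: w) - f (x + t *: v) - f (x + t *: w) + f x = phi t - phi 0.
  by rewrite /phi !scale0r !addr0; ring.
rewrite E subr0.
have [s1 s2] := small _ xit.
have [_ B1] := dP _ s1; have [_ B2] := dP _ s2.
set A1 := (X in `|X| <= _) in B1; set A2 := (X in `|X| <= _) in B2.
have -> : (g (x + xi *: v + t *: w) - g (x + xi *: v)) * t - t ^+ 2 * 'd g x w = t *
  (A1 - A2).
  have L : 'd g x (xi *: v + t *: w) = 'd g x (xi *: v) + t * 'd g x w.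
    by rewrite linearD [X in _ + X]linearZ.
  rewrite /A1 /A2 L [_ + _ + x]addrC addrA [xi *: v + x]addrC; ring.
have N1 : `|xi *: v + t *: w| <= t * (`|v| + `|w|).
  apply: le_trans (ler_normD _ _) _; rewrite !normrZ (ger0_norm (ltW t0)) ger0_norm;
    last by case/andP: xit.
  by rewrite mulrDr lerD2r ler_wpM2r//; case/andP: xit.
have N2 : `|xi *: v| <= t * `|v|.
  by rewrite normrZ ger0_norm ?ler_wpM2r//; case/andP: xit.
rewrite normrM (gtr0_norm t0) expr2 mulrCA ler_wpM2l ?(ltW t0)//.
apply: le_trans (ler_normB _ _) _.
have -> : e * t = e / C * (t * C) by rewrite mulrCA divfK ?gt_eqF// mulrC.
apply: (@le_trans _ _ (e / C * (`|xi *: v + t *: w| + `|xi *: v|))).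
  by rewrite mulrDr lerD.
rewrite ler_wpM2l ?(ltW e'0)//.
apply: (le_trans (lerD N1 N2)).
by rewrite /C -mulrDr ler_wpM2l ?(ltW t0)//; have := normr_ge0 w; lra.
Unshelve. all: by end_near. Qed.

(** The second difference is symmetric in [v] and [w], so its two asymptotic
    expansions have the same leading term. *)
Lemma Schwarz (U : set V) (f : V -> R) (x v w : V) : open U -> U x ->
  Ck_on 2 U f -> 'd (fun y => 'd f y v) x w = 'd (fun y => 'd f y w) x v.
Proof.
move=> oU Ux Cf.
have /Ck_onSE[df dCf] := Cf.
have dg a : differentiable (fun y => 'd f y a) x.
  by have /Ck_onSE[+ _] := dCf a; exact.
apply/eqP; rewrite -subr_eq0 -normr_le0; apply/ler_addgt0Pr => e e0.
rewrite add0r.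
have e20 : 0 < e / 2 by rewrite divr_gt0.
have H1 := second_difference w oU Ux df (dg v) e20.
have H2 := second_difference v oU Ux df (dg w) e20.
have [t [+ []]] := filter_ex (filterI H1 (filterI H2 (nbhs_right_gt (0 : R)))).
set X := 'd (fun y => 'd f y v) x w; set Y := 'd (fun y => 'd f y w) x v => B1 B2 t0.
have t20 : 0 < t ^+ 2 by rewrite exprn_gt0.
rewrite -(ler_pM2l t20) -{1}(gtr0_norm t20) -normrM.
set D := f (x + t *: v + t *: w) - f (x + t *: v) - f (x + t *: w) + f x in B1.
have -> : t ^+ 2 * (X - Y) = (D - t ^+ 2 * Y) - (D - t ^+ 2 * X) by ring.
apply: le_trans (ler_normB _ _) _; rewrite
  [X in _ <= X](_ : _ = e / 2 * t ^+ 2 + e / 2 * t ^+ 2); last by field.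
rewrite lerD//; apply: le_trans B2; rewrite /D [_ + t *: w + t *: v]addrAC.
by rewrite [_ - f (x + t *: w) - f (x + t *: v)]addrAC.
Qed.
End Schwarz.

(** * Ordinary differential equations *)

Section LocalLipschitz.
Context {R : realType}.

(** Finitely many partial derivatives are bounded near [x0]; the mean value
    inequality along segments of a ball does the rest. *)
Lemma C1_locally_lipschitz n m (U : set 'rV[R]_n) (f : 'rV[R]_n -> 'rV[R]_m) x0 :
  open U -> U x0 -> Ck_on 1 U f ->
  exists r L : R, [/\ 0 < r, 0 <= L, (forall y : 'rV[R]_n, `|y - x0| < r -> U y) &
    forall y z : 'rV[R]_n, `|y - x0| < r -> `|z - x0| < r ->
      `|f y - f z| <= L * `|y - z|].
Proof.
move=> oU Ux0 /Ck_onSE[df dCf].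
pose B (i : 'I_n) : R := `|'d f x0 (delta_mx 0 i)| + 1.
have nB : \forall y \near x0, U y /\ forall i : 'I_n, `|'d f y (delta_mx 0 i)| <= B i.
  apply: filterI; first exact: open_nbhs_nbhs.
  suff H (i : 'I_n) : \forall y \near x0,
    `|'d f y (delta_mx 0 i)| <= B i by exact: filter_forall H.
  have /cvgrPdist_lt/(_ _ ltr01) := dCf (delta_mx 0 i) x0 Ux0.
  have tri (a b : 'rV[R]_m) : `|a - b| < 1 -> `|b| <= `|a| + 1.
    move=> ab; rewrite -[X in `|X|](subKr a); apply: le_trans (ler_normB _ _) _.
    by rewrite lerD2l ltW.
  by apply: filterS => y; exact: tri.
have /nbhs_ballP[r /= r0 rP] := nB.
have {}rP (y : 'rV[R]_n) : `|y - x0| < r ->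
  U y /\ forall i : 'I_n, `|'d f y (delta_mx 0 i)| <= B i.
  by move=> yr; apply: rP; rewrite -ball_normE/= distrC.
have B0 i : 0 <= B i by rewrite addr_ge0.
(* For the maximum norm, the operator norm of a linear map is at most the sum of the
   norms of the images of the basis vectors. *)
exists r, (\sum_i B i); split=> //.
- by rewrite sumr_ge0.
- by move=> y /rP[].
move=> y z yr zr.
pose c (s : R) : 'rV[R]_n := z + s *: (y - z).
have cr (s : R) : 0 <= s <= 1 -> `|c s - x0| < r.
  move=> /andP[s0 s1].
  have -> : c s - x0 = (1 - s) *: (z - x0) + s *: (y - x0).
    by apply/rowP => i; rewrite !mxE; ring.
  apply: le_lt_trans (ler_normD _ _) _; rewrite !normrZ !ger0_norm ?subr_ge0//.
  have [->|s0'] := eqVneq s 0; first by rewrite subr0 mul1r mul0r addr0.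
  have s00 : 0 < s by rewrite lt_neqAle eq_sym s0'.
  have -> : r = (1 - s) * r + s * r by ring.
  by rewrite ler_ltD ?ltr_pM2l// ler_wpM2l ?subr_ge0// ltW.
have dc (s : R) : 0 <= s <= 1 ->
    is_derive s (1 : R) (f \o c) ('d f (c s) (y - z)).
  move=> /cr/rP[/df dfc _]; exact: is_derive_comp (is_derive_line z (y - z) s) dfc.
have := @mean_value_le R _ _ (f \o c) (fun s => 'd f (c s) (y - z))
  ((\sum_i B i) * `|y - z|) 0 1 ler01 dc.
have [c1 c0] : c 1 = y /\ c 0 = z by rewrite /c scale1r scale0r addr0 addrC subrK.
rewrite [(f \o c) 1]/= [(f \o c) 0]/= c1 c0 subr0 mulr1; apply.
move=> s /cr/rP[_ Bs].
rewrite [in X in X <= _](row_sum_delta (y - z)) linear_sum.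
apply: le_trans (ler_norm_sum _ _ _) _; rewrite mulr_suml; apply: ler_sum => i _.
rewrite linearZ normrZ mulrC; apply: ler_pM => //; exact: normr_entry.
Qed.
End LocalLipschitz.

Section Primitive.
Context {R : realType}.

Lemma is_derive1 (F : R -> R) (x a : R) :
  derivable F x 1 -> derive1 F x = a -> is_derive x (1 : R) F a.
Proof. by move=> dF <-; apply: DeriveDef => //; rewrite -derive1E. Qed.

(** The integral from the end point [-1]; restricting to a bounded interval makes a
    continuous function integrable. Later, time is frozen outside a shorter interval. *)
Lemma continuous_primitive (f : R -> R) : continuous f ->
  exists F : R -> R, forall x : R, `|x| < 1 -> is_derive x (1 : R) F (f x).
Proof.
move=> cf.
have fi : (@lebesgue_measure R).-integrable
    [set` Interval (BLeft (-1 : R)) (BRight (1 : R))] (constructive_ereal.EFin \o f).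
  by apply: continuous_compact_integrable;
    [exact: segment_compact|exact: continuous_subspaceT].
exists (fun x => Rintegral lebesgue_measure [set` Interval (BLeft (-1 : R)) (BRight x)]
  f).
move=> x; rewrite ltr_norml => /andP[x0 x1].
have [dF E] := @continuous_FTC1_closed R f (-1) x 1 x1 fi x0 (cf x).
exact: is_derive1 dF E.
Qed.

Lemma continuous_primitive_rV n (f : R -> 'rV[R]_n) : continuous f ->
  exists F : R -> 'rV[R]_n, F 0 = 0 /\
    forall x : R, `|x| < 1 -> is_derive x (1 : R) F (f x).
Proof.
move=> cf.
have H (j : 'I_n) : exists F : R -> R, forall x : R, `|x| < 1 ->
  is_derive x (1 : R) F (f x ord0 j).
  apply: continuous_primitive => x.
  exact: (continuous_comp (cf x) (@coord_continuous _ _ _ ord0 j _)).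
have [F FP] := choice H.
exists (fun x => \row_j (F j x - F j 0)); split.
  by apply/rowP => j; rewrite !mxE subrr.
move=> x x1; apply/is_derive_mxP => i j; rewrite ord1.
under eq_fun do rewrite mxE.
have := is_deriveB (FP j x x1) (is_derive_cst (F j 0) x (1 : R)).
by rewrite subr0.
Qed.

Lemma half_pow_lt (C e : R) : 0 < e -> exists k, C / 2 ^+ k < e.
Proof.
move=> e0.
have h : `|2^-1 : R| < 1 by rewrite ger0_norm; lra.
have /cvgrPdist_lt/(_ _ e0)[k _ /(_ k (leqnn k))] := cvg_geometric C h.
rewrite /= sub0r normrN => H; exists k.
by apply: le_lt_trans H; rewrite /geometric/= exprVn ler_norm.
Qed.

Lemma geometric_limit n (a : nat -> 'rV[R]_n) (C : R) :
  (forall k, `|a k.+1 - a k| <= C / 2 ^+ k) ->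
  exists l, forall k, `|l - a k| <= 2 * C / 2 ^+ k.
Proof.
move=> aC.
have C0 : 0 <= C by have := le_trans (normr_ge0 _) (aC 0%N); rewrite expr0 divr1.
have H k m : `|a (k + m)%N - a k| <= 2 * C / 2 ^+ k - 2 * C / 2 ^+ (k + m).
  elim: m => [|m IH]; first by rewrite addn0 !subrr normr0.
  rewrite addnS -(subrKA (a (k + m)%N)); apply: le_trans (ler_normD _ _) _.
  apply: le_trans (lerD (aC _) IH) _.
  rewrite exprS invfM; set q := _^-1; set q' := (2 ^+ k)^-1.
  have : C * q = (2 * C * q - 2 * C * (2^-1 * q)) by field.
  lra.
have H' k m : (k <= m)%N -> `|a m - a k| <= 2 * C / 2 ^+ k.
  move=> km; rewrite -(subnKC km); apply: le_trans (H _ _) _.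
  by rewrite gerBl// divr_ge0 ?mulr_ge0// exprn_ge0.
have ca : cvg (a @ \oo).
  apply: cauchy_cvg; apply: cauchy_exP => e e0.
  have [k kP] := half_pow_lt (2 * C) e0.
  exists (a k); exists k => // m /= km; rewrite -ball_normE/= distrC.
  by apply: le_lt_trans (H' _ _ km) kP.
exists (lim (a @ \oo)) => k; apply/ler_addgt0Pr => e e0.
have /cvgrPdist_lt/(_ _ e0)[m _ mP] := ca.
have := mP (maxn m k) (leq_maxl _ _) => /ltW Hm.
rewrite -(subrKA (a (maxn m k))); apply: le_trans (ler_normD _ _) _.
by rewrite addrC; apply: lerD => //; apply: H'; exact: leq_maxr.
Qed.
End Primitive.

Section Picard.
Context {R : realType}.

Lemma lipschitz_continuous_comp n (W : 'rV[R]_n -> 'rV[R]_n) (c : R -> 'rV[R]_n)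
    (L : R) : 0 <= L -> (forall s t, `|W (c s) - W (c t)| <= L * `|c s - c t|) ->
  continuous c -> continuous (W \o c).
Proof.
move=> L0 WL cc t; apply/cvgrPdist_lt => e e0.
have L1 : 0 < L + 1 by rewrite ltr_wpDl.
have e1 : 0 < e / (L + 1) by rewrite divr_gt0.
have /cvgrPdist_lt/(_ _ e1) := cc t; apply: filterS => s.
rewrite ltr_pdivlMr// => H; apply: le_lt_trans (WL _ _) _; apply: le_lt_trans H.
by rewrite mulrC ler_wpM2l// lerDl.
Qed.

Section existence.
Variables (n : nat) (W : 'rV[R]_n -> 'rV[R]_n) (u0 : 'rV[R]_n) (r L : R).
Hypotheses (r0 : 0 < r) (L0 : 0 <= L).
Hypothesis WL : forall y z, `|y - u0| < r -> `|z - u0| < r ->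
  `|W y - W z| <= L * `|y - z|.

Let B := `|W u0| + L * r + 1.
(* Small enough for the three bounds of [eP]. *)
Let e := (2 + 2 * B / r + 2 * L)^-1.

Let B0 : 0 < B.
Proof. by rewrite ltr_wpDl// addr_ge0// mulr_ge0// ltW. Qed.

Let eP : [/\ 0 < e, e < 1, e * B <= r / 2 & e * L <= 1 / 2].
Proof.
have Br : 0 <= B / r by rewrite divr_ge0// ltW.
have D0 : 0 < 2 + 2 * B / r + 2 * L.
  by rewrite -mulrA; have := L0; lra.
have e0 : 0 < e by rewrite invr_gt0.
have eD : e * 2 + e * (2 * (B / r)) + e * (2 * L) = 1.
  by rewrite -!mulrDr (mulrA 2) mulVf// gt_eqF.
have p1 : 0 <= e * (2 * (B / r)) by exact: mulr_ge0 (ltW e0) (mulr_ge0 (ler0n _ 2) Br).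
have p2 : 0 <= e * (2 * L) by exact: mulr_ge0 (ltW e0) (mulr_ge0 (ler0n _ 2) L0).
split=> //; [lra| |lra].
have : e * (B / r) <= 1 / 2 by lra.
by rewrite mulrA ler_pdivrMr//; lra.
Qed.

Let r2 y : `|y - u0| <= r / 2 -> `|y - u0| < r.
Proof. by move=> /le_lt_trans; apply; have := r0; lra. Qed.

Let WB y : `|y - u0| <= r / 2 -> `|W y| <= B.
Proof.
move=> /r2 yr; rewrite -(subrK (W u0) (W y)); apply: le_trans (ler_normD _ _) _.
have u0r : `|u0 - u0| < r by rewrite subrr normr0.
have H := WL yr u0r.
have : L * `|y - u0| <= L * r by rewrite ler_wpM2l// ltW.
rewrite /B; lra.
Qed.

Let good (c : R -> 'rV[R]_n) := [/\ continuous c, c 0 = u0 &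
  forall t, `|c t - u0| <= r / 2].

Let clip (t : R) := (`|t + e| - `|t - e|) / 2.

Let clip_le t : `|clip t| <= e.
Proof.
have [e0 _ _ _] := eP.
rewrite /clip normrM [X in _ * X]ger0_norm ?invr_ge0// ler_pdivrMr//.
apply: le_trans (ler_dist_dist _ _) _.
have -> : t + e - (t - e) = e * 2 by ring.
by rewrite ger0_norm// mulr_ge0// ltW.
Qed.

Let clip_id t : `|t| < e -> clip t = t.
Proof.
rewrite ltr_norml => /andP[h1 h2].
rewrite /clip ger0_norm; last by lra.
by rewrite ler0_norm; lra.
Qed.

Let clip_continuous : continuous clip.
Proof.
move=> t; apply: (@continuousM R _ (fun s => `|s + e| - `|s - e|) (fun=> 2^-1));
  last exact: cvg_cst.
apply: (@continuousB _ R R (fun s => `|s + e|) (fun s => `|s - e|)).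
  by apply: (continuous_comp (f := fun s => s + e));
    [apply: cvgD; [exact: cvg_id|exact: cvg_cst]|exact: norm_continuous].
by apply: (continuous_comp (f := fun s => s - e));
  [apply: cvgB; [exact: cvg_id|exact: cvg_cst]|exact: norm_continuous].
Qed.

Let near_lt (t : R) : `|t| < e -> \forall s \near t, `|s : R| < e.
Proof.
move=> te; near=> s; rewrite -(subrK t s); apply: le_lt_trans (ler_normD _ _) _.
rewrite -ltrBrDr distrC; near: s.
by apply: cvgr_dist_lt; rewrite ?subr_gt0//; exact: cvg_id.
Unshelve. all: by end_near. Qed.

Let step c : exists c', good c ->
  good c' /\ forall t : R, `|t| < e -> is_derive t (1 : R) c' (W (c t)).
Proof.
have [gc|ngc] := pselect (good c); last by exists c => /ngc.
have [e0 e1 eB eL] := eP; have [cc c0 cr] := gc.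
have [|F [F0 dF]] := continuous_primitive_rV (f := W \o c).
  by apply: lipschitz_continuous_comp L0 _ cc => s t; apply: WL; exact: r2.
exists (fun t => u0 + F (clip t)) => _; split; first split.
- move=> t; apply: cvgD; first exact: cvg_cst.
  apply: (continuous_comp (f := clip)); first exact: clip_continuous.
  apply: is_derive_continuous (dF _ _); exact: le_lt_trans (clip_le _) e1.
- by rewrite clip_id ?normr0// F0 addr0.
- move=> t; rewrite (addrC u0) addrK -[F _]subr0 -F0.
  apply: le_trans (mean_value_center (u' := W \o c) (C := B) _ _) _.
  + move=> s; rewrite !subr0 => st; apply: dF.
    by apply: le_lt_trans st _; apply: le_lt_trans (clip_le _) e1.
  + by move=> s _; exact: WB.
  + by rewrite subr0 mulrC; apply: le_trans eB; rewrite ler_wpM2r// ltW.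
- move=> t te.
  have H : is_derive t (1 : R) (fun s => u0 + F s) (W (c t)).
    have := is_deriveD (is_derive_cst u0 t (1 : R)) (dF t (lt_trans te e1)).
    by rewrite add0r.
  apply: near_eq_is_derive H.
  by have := near_lt te; apply: filterS => s /clip_id ->.
Qed.

(** Picard iteration. The iterates are defined for all times, by freezing time
    outside [[-e, e]], so that each is a primitive of a continuous function; they
    stay in the closed ball of radius [r / 2], where [W] is bounded by [B]. As
    [e * L <= 1 / 2], consecutive iterates get twice closer at each step. That the
    limit solves the equation is read off from the mean value inequality applied to
    the iterates. *)
Theorem picard_existence : exists2 d : R, 0 < d &
  exists u : R -> 'rV[R]_n, u 0 = u0 /\
    forall t : R, `|t| < d -> `|u t - u0| < r /\ is_derive t (1 : R) u (W (u t)).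
Proof.
have [e0 e1 eB eL] := eP.
have [Phi PhiP] := choice step.
pose c k := iter k Phi (fun=> u0).
have gc k : good (c k).
  elim: k => [|k IH]; last by have [] := PhiP _ IH.
  split=> // [t|t]; first exact: cvg_cst.
  by rewrite subrr normr0 divr_ge0// ltW.
have dc k (t : R) : `|t| < e -> is_derive t (1 : R) (c k.+1) (W (c k t)).
  by have [_] := PhiP _ (gc k); exact.
have cc k (t : R) : `|t| < e -> `|c k.+1 t - c k t| <= r / 2 ^+ k.
  elim: k t => [|k IH] t te.
    rewrite expr0 divr1; have [_ _ /(_ t)] := gc 1%N; rewrite /=; have := r0; lra.
  pose v s := c k.+2 s - c k.+1 s.
  have z0 : v 0 = 0.
    have [_ c2 _] := gc k.+2; have [_ c1 _] := gc k.+1.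
    by rewrite /v c2 c1; exact: subrr.
  have := @mean_value_center _ _ _ v (fun s => W (c k.+1 s) - W (c k s))
    (L * (r / 2 ^+ k)) 0 t.
  rewrite z0 !subr0 => H; apply: (le_trans (H _ _)).
  - move=> s; rewrite subr0 => /le_lt_trans/(_ te) se;
    exact: is_deriveB (dc _ _ se) (dc _ _ se).
  - move=> s; rewrite subr0 => /le_lt_trans/(_ te) se.
    apply: le_trans (WL _ _) _; [by apply: r2; have [] :=
      gc k.+1|by apply: r2; have [] := gc k|].
    by rewrite ler_wpM2l// IH.
  - rewrite exprS invfM; set q := (2 ^+ k)^-1.
    have q0 : 0 <= r * q by rewrite mulr_ge0 ?invr_ge0 ?exprn_ge0// ltW.
    have Lt : L * `|t| <= 1 / 2.
      by apply: le_trans eL; rewrite mulrC ler_wpM2r// ltW.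
    have -> : L * (r * q) * `|t| = (L * `|t|) * (r * q) by ring.
    have -> : r * (2^-1 * q) = 1 / 2 * (r * q) by field.
    by rewrite ler_wpM2r.
have lim_ex (t : R) : exists l, `|t| < e -> forall k, `|l - c k t| <= 2 * r / 2 ^+ k.
  have [te|_] := ltP `|t| e; last by exists 0.
  by have [l lP] := geometric_limit (fun k => cc k t te); exists l.
have [u uP] := choice lim_ex.
have le_lim (t a : R) (x : 'rV[R]_n) : `|t| < e -> (forall k, `|c k.+1 t - x| <= a) ->
  `|u t - x| <= a.
  move=> te H; apply/ler_addgt0Pr => d d0.
  have [k kd] := half_pow_lt r d0.
  rewrite -(subrKA (c k.+1 t)); apply: le_trans (ler_normD _ _) _.
  rewrite addrC lerD//; apply: le_trans (uP t te k.+1) _.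
  rewrite exprS invfM (_ : _ * _ = r / 2 ^+ k) ?(ltW kd)//.
  by set q := (2 ^+ k)^-1; field.
have u00 : u 0 = u0.
  apply/eqP; rewrite -subr_eq0 -normr_le0; apply: le_lim; rewrite ?normr0// => k.
  by have [_ -> _] := gc k.+1; rewrite subrr normr0.
have ur (t : R) : `|t| < e -> `|u t - u0| <= r / 2.
  by move=> te; apply: le_lim => // k; have [] := gc k.+1.
exists e => //; exists u; split=> // t te; split; first exact/r2/ur.
apply: is_derive_eps => d d0.
have LB : 0 < L * B + 1 by rewrite ltr_wpDl// mulr_ge0// ltW.
have nh : \forall h \near (0 : R), `|h| < e - `|t|.
  by apply: nbhs0_lt; rewrite subr_gt0.
have nh' : \forall h \near (0 : R), `|h| < d / (L * B + 1).
  by apply: nbhs0_lt; rewrite divr_gt0.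
apply: filterS2 nh nh' => h ht hd.
have seg (s : R) : `|s - t| <= `|h + t - t| -> `|s| < e.
  rewrite addrK => sh; rewrite -(subrK t s); apply: le_lt_trans (ler_normD _ _) _.
  by rewrite -ltrBrDr; exact: le_lt_trans sh ht.
have cB k (s : R) : `|s - t| <= `|h + t - t| -> `|c k.+1 s - c k.+1 t| <= B * `|h|.
  move=> sh; apply: (@le_trans _ _ (B * `|s - t|)); last first.
    by rewrite ler_wpM2l ?(ltW B0)//; move: sh; rewrite addrK.
  apply: (@mean_value_center _ _ _ (c k.+1) (fun s => W (c k s))).
    by move=> a /le_trans/(_ sh)/seg; exact: dc.
  by move=> a _; apply: WB; have [] := gc k.
(* Compare an iterate with the affine curve of velocity [W (u t)]. *)
have key k : `|c k.+2 (h + t) - c k.+2 t - h *: W (u t)| <=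
    L * (B * `|h| + 2 * r / 2 ^+ k.+1) * `|h|.
  pose v s := c k.+2 s - (0 + s *: W (u t)).
  have -> : c k.+2 (h + t) - c k.+2 t - h *: W (u t) = v (h + t) - v t.
    by rewrite /v !add0r scalerDl; apply/rowP => j; rewrite !mxE; ring.
  have := @mean_value_center _ _ _ v (fun s => W (c k.+1 s) - W (u t))
    (L * (B * `|h| + 2 * r / 2 ^+ k.+1)) t (h + t).
  rewrite [X in _ -> _ -> _ <= _ * `|X|]addrK; apply.
    by move=> s /seg se; apply: is_deriveB (dc _ _ se) (is_derive_line 0 (W (u t)) s).
  move=> s sh; have se := seg _ sh.
  apply: le_trans (WL _ _) _.
    by apply: r2; have [] := gc k.+1.
    exact/r2/ur.
  rewrite ler_wpM2l// -(subrKA (c k.+1 t)); apply: le_trans (ler_normD _ _) _.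
  by rewrite lerD ?cB// distrC; exact: uP.
have main : `|u (h + t) - u t - h *: W (u t)| <= L * (B * `|h|) * `|h|.
  apply/ler_addgt0Pr => a a0.
  have [k ka] := half_pow_lt (4 * r + L * (2 * r) * `|h|) a0.
  have hte : `|h + t| < e by apply: seg; rewrite addrK.
  have E1 := uP _ hte k.+2; have E2 := uP _ te k.+2; have E3 := key k.
  have -> : u (h + t) - u t - h *: W (u t) = (u (h + t) - c k.+2 (h + t)) +
    ((c k.+2 (h + t) - c k.+2 t - h *: W (u t)) - (u t - c k.+2 t)).
    by apply/rowP => j; rewrite !mxE; ring.
  apply: le_trans (ler_normD _ _) _; apply: le_trans
    (lerD E1 (le_trans (ler_normB _ _) (lerD E3 E2))) _.
  move: ka; rewrite !exprS !invfM; set q := (2 ^+ k)^-1 => ka.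
  have q0 : 0 <= q by rewrite invr_ge0 exprn_ge0.
  have p1 : 0 <= r * q by rewrite mulr_ge0// ltW.
  have p2 : 0 <= L * (r * q * `|h|) by rewrite !mulr_ge0// ltW.
  have -> : 2 * r * (2^-1 * (2^-1 * q)) = 2^-1 * (r * q) by field.
  have -> : L * (B * `|h| + 2 * r * (2^-1 * q)) * `|h| = L * (B * `|h|) * `|h| + L *
    (r * q * `|h|) by field.
  rewrite (_ : (4 * r + L * (2 * r) * `|h|) * q = 4 * (r * q) + 2 *
    (L * (r * q * `|h|))) in ka; last by ring.
  lra.
apply: le_trans main _; rewrite ler_wpM2r// mulrA.
apply: le_trans (_ : (L * B + 1) * `|h| <= _); first by rewrite ler_wpM2r// lerDl.
by rewrite mulrC -ler_pdivlMr// ltW.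
Qed.
End existence.
End Picard.

Section Uniqueness.
Context {R : realType}.

Lemma near0_ball (P : R -> Prop) : (\forall t \near (0 : R), P t) ->
  exists2 d : R, 0 < d & forall t, `|t| < d -> P t.
Proof.
move=> /nbhs_ballP[d d0 dP]; exists d => // t td; apply: dP.
by rewrite -ball_normE/= sub0r normrN.
Qed.

Lemma ball_near0 (P : R -> Prop) (d : R) : 0 < d ->
  (forall t, `|t| < d -> P t) -> \forall t \near (0 : R), P t.
Proof. by move=> d0 H; apply: filterS (nbhs0_lt d0) => t; exact: H. Qed.

(** On a time interval so short that [L * e <= 1 / 2], the maximum of the distance
    between both solutions is at most half of itself. *)
Theorem picard_uniqueness n (W : 'rV[R]_n -> 'rV[R]_n) (u0 : 'rV[R]_n) (r L : R)
    (u v : R -> 'rV[R]_n) : 0 < r -> 0 <= L ->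
  (forall y z, `|y - u0| < r -> `|z - u0| < r -> `|W y - W z| <= L * `|y - z|) ->
  u 0 = u0 -> v 0 = u0 ->
  (\forall t \near (0 : R), is_derive t (1 : R) u (W (u t))) ->
  (\forall t \near (0 : R), is_derive t (1 : R) v (W (v t))) ->
  \forall t \near (0 : R), u t = v t.
Proof.
move=> r0 L0 WL uu0 vu0 du dv.
have nb (w : R -> 'rV[R]_n) : w 0 = u0 ->
  (\forall t \near (0 : R), is_derive t (1 : R) w (W (w t))) ->
    \forall t \near (0 : R), `|w t - u0| < r.
  move=> w0 /nbhs_singleton/is_derive_continuous/cvgrPdist_lt/(_ _ r0).
  by rewrite w0; apply: filterS => t; rewrite distrC.
have [d d0 dP] := near0_ball (filterI (filterI du dv)
  (filterI (nb u uu0 du) (nb v vu0 dv))).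
pose e := Num.min (d / 2) (2 * L + 1)^-1.
have L2 : 0 < 2 * L + 1 by rewrite ltr_wpDl// mulr_ge0.
have e0 : 0 < e by rewrite lt_min divr_gt0//= invr_gt0.
have ed : e < d by rewrite /e gt_min; apply/orP; left; have := d0; lra.
have eL : L * e <= 1 / 2.
  have : L * e <= L * (2 * L + 1)^-1 by rewrite ler_wpM2l// /e ge_min lexx orbT.
  move=> /le_trans; apply; rewrite ler_pdivrMr//; lra.
pose f (t : R) : R := `|u t - v t|.
have se (t : R) : t \in `[- e, e] -> `|t| < d.
  by rewrite in_itv/= -ler_norml => /le_lt_trans; exact.
have cf : {within `[- e, e], continuous f}.
  apply: continuous_in_subspaceT => t /set_mem te.
  have [[dut dvt] _] := dP _ (se t te).
  apply: (continuous_comp (f := fun t => u t - v t) (g := fun x => `|x|));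
    last exact: norm_continuous.
  by apply: continuousB; [exact: is_derive_continuous dut|exact: is_derive_continuous
    dvt].
have eNe : - e <= e by rewrite -subr_ge0 opprK addr_ge0// ltW.
have [c cin cmax] := EVT_max eNe cf.
have fc0 : f c <= 0.
  have := @mean_value_center _ _ _ (fun t => u t - v t) (fun t => W (u t) - W (v t))
    (L * f c) 0 c.
  rewrite uu0 vu0 subrr !subr0 => H.
  have ce : `|c| <= e by move: cin; rewrite in_itv/= -ler_norml.
  have /le_trans : f c <= L * f c * `|c|.
    apply: H => t; rewrite subr0 => tc.
      have [[dut dvt] _] := dP _ (le_lt_trans (le_trans tc ce) ed).
      exact: is_deriveB dut dvt.
    have [_ [Bu Bv]] := dP _ (le_lt_trans (le_trans tc ce) ed).
    apply: le_trans (WL _ _ Bu Bv) _; rewrite ler_wpM2l//; apply: cmax.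
    by rewrite in_itv/= -ler_norml; exact: le_trans tc ce.
  have fc : 0 <= f c by rewrite normr_ge0.
  have p : L * f c * `|c| <= 1 / 2 * f c.
    rewrite mulrAC ler_wpM2r//; apply: le_trans eL; exact: ler_wpM2l.
  by move=> /(_ _ p); lra.
apply: ball_near0 e0 _ => t te; apply/eqP; rewrite -subr_eq0 -normr_le0.
by apply: le_trans fc0; apply: cmax; rewrite in_itv/= -ler_norml ltW.
Qed.
End Uniqueness.

(** * Hamilton's equations and the cotangent lift *)

Section SymplecticGradient.
Context {R : realType}.

Definition dot n (a b : 'rV[R]_n) : R := (a *m b^T) ord0 ord0.

Lemma dotE n (a b : 'rV[R]_n) : dot a b = \sum_i a ord0 i * b ord0 i.
Proof. by rewrite /dot mxE; apply: eq_bigr => i _; rewrite mxE. Qed.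

Lemma dot_delta n (a : 'rV[R]_n) i : dot a (delta_mx 0 i) = a ord0 i.
Proof. by rewrite /dot trmx_delta -colE mxE. Qed.

Lemma dot_inj n (a b : 'rV[R]_n) : (forall w, dot a w = dot b w) -> a = b.
Proof. by move=> H; apply/rowP => i; have := H (delta_mx 0 i); rewrite !dot_delta. Qed.

Lemma dot_mulmx n p (a : 'rV[R]_n) (A : 'M[R]_(n, p)) (b : 'rV[R]_p) :
  dot (a *m A) b = dot a (b *m A^T).
Proof. by rewrite /dot trmx_mul trmxK mulmxA. Qed.

Lemma dotDl n (a b c : 'rV[R]_n) : dot (a + b) c = dot a c + dot b c.
Proof. by rewrite /dot mulmxDl mxE. Qed.

Lemma dotNl n (a c : 'rV[R]_n) : dot (- a) c = - dot a c.
Proof. by rewrite /dot mulNmx mxE. Qed.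

Lemma dotC n (a b : 'rV[R]_n) : dot a b = dot b a.
Proof. by rewrite !dotE; apply: eq_bigr => i _; rewrite mulrC. Qed.

(** In a canonical chart [(q, p)] this is the Hamiltonian vector field
    [(dH/dp, - dH/dq)]. *)
Definition sgrad d (H : 'rV[R]_(d + d) -> R) (u : 'rV[R]_(d + d)) : 'rV[R]_(d + d) :=
  row_mx (\row_i 'd H u (row_mx 0 (delta_mx 0 i)))
         (- \row_i 'd H u (row_mx (delta_mx 0 i) 0)).

Lemma sgrad_l d (H : 'rV[R]_(d + d) -> R) u w :
  dot (lsubmx (sgrad H u)) w = 'd H u (row_mx 0 w).
Proof.
rewrite row_mxKl dotE [w in RHS]row_sum_delta.
have -> : row_mx (0 : 'rV[R]_d) (\sum_j w 0 j *: delta_mx 0 j : 'rV[R]_d) =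
   \sum_j w 0 j *: row_mx 0 (delta_mx 0 j).
  rewrite (big_morph (row_mx (0 : 'rV[R]_d)) (id1 := 0) (op1 := +%R)) ?row_mx0//.
    by apply: eq_bigr => j _; rewrite scale_row_mx scaler0.
  by move=> a b; rewrite add_row_mx addr0.
rewrite linear_sum; apply: eq_bigr => j _.
by rewrite linearZ mxE mulrC.
Qed.

Lemma sgrad_r d (H : 'rV[R]_(d + d) -> R) u w :
  dot (rsubmx (sgrad H u)) w = - 'd H u (row_mx w 0).
Proof.
rewrite row_mxKr dotNl dotE [w in RHS]row_sum_delta.
have -> : row_mx (\sum_j w 0 j *: delta_mx 0 j : 'rV[R]_d) (0 : 'rV[R]_d) =
   \sum_j w 0 j *: row_mx (delta_mx 0 j) 0.
  rewrite (big_morph (fun a => row_mx a (0 : 'rV[R]_d)) (id1 := 0) (op1 := +%R))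
    ?row_mx0//.
    by apply: eq_bigr => j _; rewrite scale_row_mx scaler0.
  by move=> a b; rewrite add_row_mx addr0.
apply: (congr1 (fun z : R => - z)); rewrite linear_sum; apply: eq_bigr => j _.
by rewrite linearZ mxE mulrC.
Qed.

Lemma Ck_on_sgrad d k (U : set 'rV[R]_(d + d)) (H : 'rV[R]_(d + d) -> R) :
  open U -> Ck_on k.+1 U H -> Ck_on k U (sgrad H).
Proof.
move=> oU /Ck_onSE[_ CH].
apply: Ck_on_row_mx => //; apply: Ck_on_mx => // i j; under eq_fun do rewrite !mxE.
  exact: CH.
apply: (@Ck_on_ext _ _ _ k U (fun x => -1 * 'd H x (row_mx (delta_mx 0 j) 0))) => //.
  by move=> x _; rewrite mulN1r.
by apply: Ck_onM => //; exact: Ck_on_cst.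
Qed.

Lemma is_derive_unique (W : normedModType R) (f : R -> W) t a b :
  is_derive t (1 : R) f a -> is_derive t (1 : R) f b -> a = b.
Proof. by move=> [_ <-] [_ <-]. Qed.
End SymplecticGradient.

Section CotangentLift.
Context {R : realType} {d e : nat}.
Variables (U : set 'rV[R]_d) (P : 'rV[R]_d -> 'rV[R]_e).
Variables (HM : 'rV[R]_(d + d) -> R) (HN : 'rV[R]_(e + e) -> R).
Hypotheses (oU : open U) (CP : Ck_on 2 U P).

(** For a covector [q] at [P y], this is the point [y] with the pulled back covector,
    in canonical coordinates. *)
Definition colift y (q : 'rV[R]_e) : 'rV[R]_(d + d) := row_mx y (q *m ('J P y)^T).

Hypothesis intertwine : forall y, U y -> forall q, HM (colift y q) = HN (row_mx (P y) q).

Lemma diff_jacobian y : U y -> differentiable (jacobian P) y.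
Proof. by move=> Uy; have /Ck_onSE[+ _] := Ck_on_jacobian oU CP; exact. Qed.

Lemma near_line (y w : 'rV[R]_d) : U y -> \forall s \near (0 : R), U (y + s *: w).
Proof.
move=> Uy; have : nbhs (y + (0 : R) *: w) U.
  by rewrite scale0r addr0; exact: open_nbhs_nbhs.
exact: (is_derive_continuous (is_derive_line y w 0)).
Qed.

(** The symmetry of the second differential of [P], contracted with two vectors; the
    matrix ['d (jacobian P) y b] lists the second partial derivatives in direction
    [b]. *)
Lemma jacobian_sym y a b : U y ->
  a *m 'd (jacobian P) y b = b *m 'd (jacobian P) y a.
Proof.
move=> Uy; have [dP dCP] := (Ck_onSE _ _ _).1 CP.
have E c w : c *m 'd (jacobian P) y w = 'd (fun y => 'd P y c) y w.
  have y0 : y + (0 : R) *: w = y by rewrite scale0r addr0.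
  have dl := is_derive_line y w 0.
  have dJ : differentiable (jacobian P) (y + (0 : R) *: w) by rewrite y0;
    exact: diff_jacobian.
  have D1 := is_derive_mulmx (is_derive_cst c (0 : R) (1 : R)) (is_derive_comp dl dJ).
  have dC : differentiable (fun y => 'd P y c) (y + (0 : R) *: w).
    by rewrite y0; have /Ck_onSE[+ _] := dCP c; exact.
  have D2 := is_derive_comp dl dC.
  move: D1 D2; rewrite y0 mul0mx addr0 => D1 D2.
  apply: (is_derive_unique D1).
  rewrite (_ : (fun s => _) = (fun y => 'd P y c) \o (fun r : R => y + r *: w))//.
  by apply/funext => s; rewrite /= jacobianE.
rewrite !E; apply/rowP => j.
have E2 c w : ('d (fun y => 'd P y c) y w) ord0 j = 'd
  (fun y => 'd (fun y => P y ord0 j) y c) y w.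
  have dC : differentiable (fun y => 'd P y c) y.
    by have /Ck_onSE[+ _] := dCP c; exact.
  have [dE <-] := diff_entry ord0 j dC.
  have N : {near y, (fun y => 'd P y c ord0 j) =1
    (fun y => 'd (fun y => P y ord0 j) y c)}.
    have := open_nbhs_nbhs (conj oU Uy); apply: filterS => x /dP dx.
    by have [_ ->] := diff_entry ord0 j dx.
  by have [_ E3] := diff_near_eq N dE; exact: (esym (congr1 (@^~ w) E3)).
rewrite !E2; apply: Schwarz oU Uy _; exact: Ck_on_entry.
Qed.

Section at_point.
Variables (y : 'rV[R]_d) (q : 'rV[R]_e).
Hypotheses (Uy : U y) (dHM : differentiable HM (colift y q))
  (dHN : differentiable HN (row_mx (P y) q)).

(** Differentiate the intertwining relation in the covector variable: the projection
    maps the horizontal velocity of [HM] to that of [HN]. *)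
Lemma lift_fiber : lsubmx (sgrad HN (row_mx (P y) q)) =
  lsubmx (sgrad HM (colift y q)) *m 'J P y.
Proof.
apply: dot_inj => w; rewrite dot_mulmx !sgrad_l.
have q0 : q + (0 : R) *: w = q by rewrite scale0r addr0.
have dq := is_derive_line q w 0.
have dN := is_derive_row_mx (is_derive_cst (P y) (0 : R) (1 : R)) dq.
have dM := is_derive_row_mx (is_derive_cst y (0 : R) (1 : R))
  (is_derive_mulmx dq (is_derive_cst ('J P y)^T (0 : R) (1 : R))).
move: dM; rewrite mulmx0 add0r => dM.
have dHM' : differentiable HM (colift y (q + (0 : R) *: w)) by rewrite q0.
have dHN' : differentiable HN (row_mx (P y) (q + (0 : R) *: w)) by rewrite q0.
have DN := is_derive_comp dN dHN'; have DM := is_derive_comp dM dHM'.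
move: DN DM; rewrite /cst q0 => DN DM; apply: (is_derive_unique DN).
rewrite (_ : _ \o _ = (HM \o (fun s => row_mx y ((q + s *: w) *m ('J P y)^T))))//.
by apply/funext => s; rewrite /= intertwine.
Qed.

(** Differentiate the intertwining relation in the base variable. The pulled back
    covector depends on the base point through the Jacobian matrix, whence the
    second derivatives of [P]. *)
Lemma lift_base w :
  'd HM (colift y q) (row_mx w (q *m ('d (jacobian P) y w)^T)) =
  'd HN (row_mx (P y) q) (row_mx ('d P y w) 0).
Proof.
have [dP _] := (Ck_onSE _ _ _).1 CP.
have y0 : y + (0 : R) *: w = y by rewrite scale0r addr0.
have dy := is_derive_line y w 0.
have dPy : differentiable P (y + (0 : R) *: w) by rewrite y0; exact: dP.
have dJy : differentiable (jacobian P) (y + (0 : R) *: w) by rewrite y0;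
  exact: diff_jacobian.
have dN := is_derive_row_mx (is_derive_comp dy dPy) (is_derive_cst q (0 : R) (1 : R)).
have dM := is_derive_row_mx dy (is_derive_mulmx (is_derive_cst q (0 : R) (1 : R))
  (is_derive_trmx (is_derive_comp dy dJy))).
have dHM' : differentiable HM (colift (y + (0 : R) *: w) q) by rewrite y0.
have dHN' : differentiable HN (row_mx (P (y + (0 : R) *: w)) q) by rewrite y0.
have DN := is_derive_comp dN dHN'; have DM := is_derive_comp dM dHM'.
move: DN DM; rewrite /cst/= y0 mul0mx addr0 => DN DM; apply: (is_derive_unique DM).
apply: near_eq_is_derive DN.
by have := near_line w Uy; apply: filterS => s Us; rewrite /= -intertwine.
Qed.
End at_point.

(** The base point follows [HM] and the covector follows [HN]. By [lift_fiber] the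
    projected base point then has the velocity that [HN] prescribes. What remains is
    the momentum of the pulled back curve: differentiating [q *m ('J P x)^T] along
    the curve produces a second derivative of [P], and so does [lift_base]; the two
    terms cancel by [jacobian_sym]. *)
Theorem lift_flow (x : R -> 'rV[R]_d) (q : R -> 'rV[R]_e) (t : R) :
  U (x t) -> differentiable HM (colift (x t) (q t)) ->
  differentiable HN (row_mx (P (x t)) (q t)) ->
  is_derive t (1 : R) x (lsubmx (sgrad HM (colift (x t) (q t)))) ->
  is_derive t (1 : R) q (rsubmx (sgrad HN (row_mx (P (x t)) (q t)))) ->
  is_derive t (1 : R) (fun s => colift (x s) (q s)) (sgrad HM (colift (x t) (q t))) /\
  is_derive t (1 : R) (fun s => row_mx (P (x s)) (q s))
    (sgrad HN (row_mx (P (x t)) (q t))).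
Proof.
move=> Ux dHM dHN dx dq.
have [dP _] := (Ck_onSE _ _ _).1 CP.
have dPx := is_derive_comp dx (dP _ Ux).
have dJx := is_derive_comp dx (diff_jacobian Ux).
split; last first.
  apply: (is_derive_eq (is_derive_row_mx dPx dq)).
  rewrite -jacobianE -(lift_fiber Ux dHM dHN); exact: hsubmxK.
have D := is_derive_row_mx dx (is_derive_mulmx dq (is_derive_trmx dJx)).
apply: (is_derive_eq D); rewrite -[RHS]hsubmxK; congr row_mx.
apply: dot_inj => w; rewrite sgrad_r.
set X := lsubmx (sgrad HM _).
have B := lift_base Ux dHM dHN w.
have S : row_mx w (q t *m ('d (jacobian P) (x t) w)^T) =
  row_mx w 0 + row_mx 0 (q t *m ('d (jacobian P) (x t) w)^T) by rewrite add_row_mx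
    addr0 add0r.
move: B; rewrite S linearD -sgrad_l -/X => B.
have E : 'd HN (row_mx (P (x t)) (q t)) (row_mx ('d P (x t) w) 0) =
  - dot (rsubmx (sgrad HN (row_mx (P (x t)) (q t))))
    ('d P (x t) w) by rewrite sgrad_r opprK.
move: B; rewrite E => B.
rewrite dotDl !dot_mulmx !trmxK.
rewrite (jacobian_sym w X Ux).
move: B; rewrite -jacobianE -dot_mulmx [dot _ (q t)]dotC [(jacobian P \o x) t]/=.
set a := 'd HM _ _; set b := dot (q t) _; set c := dot (rsubmx _) _ => B.
by rewrite -[c]opprK -B opprD addrC subrK.
Qed.
End CotangentLift.

(** * Differentials in charts *)

Section LocalMaps.
Context {R : realType}.
Implicit Types X Y Z : charted R.

Definition lmap X Y (F : X -> Y) (x0 : X) (y0 : Y) : 'rV[R]_(mdim X) -> 'rV[R]_(mdim Y) :=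
  chart y0 \o F \o cinv x0.

Definition ldom X Y (F : X -> Y) (x0 : X) (y0 : Y) : set 'rV[R]_(mdim X) :=
  chart x0 @` (cdom x0 `&` F @^-1` cdom y0).

Definition cimg X (x0 : X) : set 'rV[R]_(mdim X) := chart x0 @` cdom x0.

Definition chartsK X := forall x0 x : X, cdom x0 x -> cinv x0 (chart x0 x) = x.

Lemma cimgP X (x0 : X) u : chartsK X -> cimg x0 u ->
  cdom x0 (cinv x0 u) /\ chart x0 (cinv x0 u) = u.
Proof. by move=> XK [x dx <-]; rewrite XK. Qed.

Lemma mem_cimg X (x0 x : X) : cdom x0 x -> cimg x0 (chart x0 x).
Proof. by move=> dx; exists x. Qed.

Lemma mem_ldom X Y (F : X -> Y) x0 y0 x :
  cdom x0 x -> cdom y0 (F x) -> ldom F x0 y0 (chart x0 x).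
Proof. by move=> dx dFx; exists x. Qed.

Lemma ldomP X Y (F : X -> Y) x0 y0 u : chartsK X -> ldom F x0 y0 u ->
  [/\ cdom x0 (cinv x0 u), cdom y0 (F (cinv x0 u)) & chart x0 (cinv x0 u) = u].
Proof. by move=> XK [x [dx dFx] <-]; rewrite XK. Qed.

Lemma lmapE X Y (F : X -> Y) x0 y0 x : chartsK X -> cdom x0 x ->
  lmap F x0 y0 (chart x0 x) = chart y0 (F x).
Proof. by move=> XK dx; rewrite /lmap/= XK. Qed.

Lemma open_ldom X Y (F : X -> Y) x0 y0 : smooth F -> open (ldom F x0 y0).
Proof. by move=> /(_ x0 y0)[]. Qed.

Lemma Ck_on_lmap X Y (F : X -> Y) x0 y0 k : smooth F ->
  Ck_on k (ldom F x0 y0) (lmap F x0 y0).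
Proof. by move=> /(_ x0 y0)[_]; exact. Qed.

Lemma diff_lmap X Y (F : X -> Y) x0 y0 x : smooth F ->
  cdom x0 x -> cdom y0 (F x) -> differentiable (lmap F x0 y0) (chart x0 x).
Proof.
move=> sF dx dFx; have /Ck_onSE[+ _] := @Ck_on_lmap X Y F x0 y0 1 sF.
by apply; exact: mem_ldom.
Qed.

Lemma open_cimg X (x0 : X) : is_manifold X -> open (cimg x0).
Proof.
move=> mX; have := @open_ldom X X (fun x => x) x0 x0 (mfd_compat mX).
by rewrite /ldom (_ : _ `&` _ = cdom x0)// preimage_id setIid.
Qed.

Lemma mulmx_row_inj m n (A B : 'M[R]_(m, n)) :
  (forall v : 'rV[R]_m, v *m A = v *m B) -> A = B.
Proof. by move=> AB; apply/row_matrixP => i; rewrite !rowE. Qed.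

Lemma jacobian_near_eq n p (f g : 'rV[R]_n -> 'rV[R]_p) x :
  {near x, f =1 g} -> differentiable f x -> 'J g x = 'J f x.
Proof.
move=> fg df; have [_ E] := diff_near_eq fg df.
apply: mulmx_row_inj => v; exact: etrans (jacobianE g x _)
  (etrans (congr1 (@^~ _) E) (esym (jacobianE f x _))).
Qed.

Lemma jacobian_comp n p q (f : 'rV[R]_n -> 'rV[R]_p) (g : 'rV[R]_p -> 'rV[R]_q) x :
  differentiable f x -> differentiable g (f x) -> 'J (g \o f) x = 'J f x *m 'J g (f x).
Proof.
move=> df dg; apply: mulmx_row_inj => v; rewrite mulmxA.
by apply: etrans (jacobianE _ _ _) _; rewrite !jacobianE; exact: diff_compv.
Qed.

Lemma near_ldom X Y (F : X -> Y) x0 y0 x : smooth F ->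
  cdom x0 x -> cdom y0 (F x) -> \forall u \near chart x0 x, ldom F x0 y0 u.
Proof.
move=> sF dx dFx; apply: open_nbhs_nbhs; split; first exact: open_ldom.
exact: mem_ldom.
Qed.

(** All change-of-chart formulas for differentials are instances of this chain rule,
    with one of the maps equal to the identity. *)
Lemma jacobian_lmap_comp X Y Z (F : X -> Y) (G : Y -> Z) x0 y0 w0 x :
  chartsK X -> chartsK Y -> smooth F -> smooth G ->
  cdom x0 x -> cdom y0 (F x) -> cdom w0 (G (F x)) ->
  'J (lmap (G \o F) x0 w0) (chart x0 x) =
  'J (lmap F x0 y0) (chart x0 x) *m 'J (lmap G y0 w0) (chart y0 (F x)).
Proof.
move=> XK YK sF sG dx dFx dGx.
have dF := diff_lmap sF dx dFx; have dG := diff_lmap sG dFx dGx.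
rewrite -(lmapE F y0 XK dx) in dG *.
apply: etrans (jacobian_comp dF dG); apply: jacobian_near_eq (differentiable_comp dF dG).
have := near_ldom sF dx dFx; apply: filterS => u /(ldomP XK)[_ Fu _].
by rewrite /lmap/= YK.
Qed.

Lemma jacobian_lmap_id X (x0 x : X) : chartsK X -> smooth (fun x : X => x) ->
  cdom x0 x -> 'J (lmap (fun x : X => x) x0 x0) (chart x0 x) = 1%:M.
Proof.
move=> XK sX dx.
have -> : 'J (lmap (fun x : X => x) x0 x0) (chart x0 x) = 'J id (chart x0 x).
  apply: jacobian_near_eq; last exact: (@ex_diff _ _ _ _ _ _ _ (is_diff_id _)).
  have := near_ldom sX dx dx; apply: filterS => u /(ldomP XK)[_ _ E].
  exact: (esym E).
apply: mulmx_row_inj => v; rewrite jacobianE mulmx1.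
exact: (congr1 (@^~ _) (@diff_val _ _ _ _ _ _ _ (is_diff_id _))).
Qed.

Lemma frameE X (x0 x : X) : frame x0 x = 'J (lmap (fun x : X => x) x0 x) (chart x0 x).
Proof. by []. Qed.

Section manifolds.
Variables (X Y Z : charted R).
Hypotheses (mX : is_manifold X) (mY : is_manifold Y) (mZ : is_manifold Z).

Lemma frame_id (x : X) : frame x x = 1%:M.
Proof.
by rewrite frameE jacobian_lmap_id//; [exact: mfd_chartK|exact: mfd_compat|exact:
  mfd_mem].
Qed.

Lemma frame_unit (x0 x : X) : cdom x0 x -> frame x0 x \in unitmx.
Proof.
move=> dx; have [XK sX] := (mfd_chartK mX, mfd_compat mX).
have := @jacobian_lmap_comp X X X (fun x => x) (fun x => x) x0 x x0 x XK XK sX sX dx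
  (mfd_mem mX x) dx.
rewrite (_ : _ \o _ = fun x : X => x)// jacobian_lmap_id// => /esym/mulmx1_unit[+ _];
  exact.
Qed.

(** Both sides are the Jacobian matrix of [F] between the charts at [x0] and at [F x]. *)
Lemma frame_tmap (F : X -> Y) x0 y0 x : smooth F -> cdom x0 x -> cdom y0 (F x) ->
  frame x0 x *m tmap F x = 'J (lmap F x0 y0) (chart x0 x) *m frame y0 (F x).
Proof.
move=> sF dx dFx; have [XK sX] := (mfd_chartK mX, mfd_compat mX).
have [YK sY] := (mfd_chartK mY, mfd_compat mY).
rewrite -(@jacobian_lmap_comp X X Y (fun x => x) F x0 x (F x) x XK XK sX sF dx
  (mfd_mem mX x) (mfd_mem mY (F x))).
exact: (@jacobian_lmap_comp X Y Y F (fun y => y) x0 y0 (F x) x XK YK sF sY dx dFx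
  (mfd_mem mY (F x))).
Qed.

Lemma tmap_comp (F : X -> Y) (G : Y -> Z) x : smooth F -> smooth G ->
  tmap (G \o F) x = tmap F x *m tmap G (F x).
Proof.
move=> sF sG; apply: jacobian_lmap_comp => //;
  [exact: mfd_chartK|exact: mfd_chartK|exact: mfd_mem..].
Qed.
End manifolds.
End LocalMaps.

(** * Canonical charts of the cotangent bundle *)

Section CotangentCharts.
Context {R : realType}.
Implicit Types X Y : charted R.

(** The chart of [cotangent X] at [z0]; named to fix the shape of its coordinates. *)
Definition ccoord X (z0 z : cotangent X) : 'rV[R]_(mdim X + mdim X) :=
  row_mx (chart z0.1 z.1) (frame z0.1 z.1 *m z.2)^T.

Definition copoint X (z0 : cotangent X) (u : 'rV[R]_(mdim X + mdim X)) : cotangent X :=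
  @cinv R (cotangent X) z0 u.

Definition hloc X (h : cotangent X -> R) (z0 : cotangent X)
  (u : 'rV[R]_(mdim X + mdim X)) : R := h (copoint z0 u).

Definition ctan_img X (x0 : X) : set 'rV[R]_(mdim X + mdim X) :=
  [set u | cimg x0 (lsubmx u)].

(** The regularity that makes the Hamiltonian vector field locally Lipschitz. *)
Definition C2ham X (h : cotangent X -> R) :=
  forall z0 : cotangent X, Ck_on 2 (ctan_img z0.1) (hloc h z0).

Lemma continuous_lsubmx m n p : continuous (@lsubmx R m n p).
Proof. by move=> A; exact/differentiable_continuous/differentiable_lsubmx. Qed.

Section one_manifold.
Variables (X : charted R) (mX : is_manifold X).

Lemma open_ctan_img (x0 : X) : open (ctan_img x0).
Proof.
apply: open_comp; last exact: open_cimg.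
by move=> A _; exact: continuous_lsubmx.
Qed.

Lemma ccoordK (z0 z : cotangent X) : cdom z0.1 z.1 -> copoint z0 (ccoord z0 z) = z.
Proof.
move=> dz; rewrite /copoint /ccoord /= row_mxKl row_mxKr (mfd_chartK mX)// trmxK.
by rewrite mulmxA mulVmx ?mul1mx -?surjective_pairing//; exact: frame_unit.
Qed.

Lemma copointK (z0 : cotangent X) u : ctan_img z0.1 u ->
  cdom z0.1 (copoint z0 u).1 /\ ccoord z0 (copoint z0 u) = u.
Proof.
move=> /(cimgP (mfd_chartK mX))[du uK]; split=> //.
rewrite /ccoord /copoint/= uK mulmxA mulmxV ?mul1mx ?trmxK ?hsubmxK//.
exact: frame_unit.
Qed.

Lemma ctan_img_ccoord (z0 z : cotangent X) : cdom z0.1 z.1 -> ctan_img z0.1 (ccoord z0 z).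
Proof. by move=> dz; rewrite /ctan_img /ccoord/= row_mxKl; exact: mem_cimg. Qed.

Lemma diff_hloc (h : cotangent X -> R) (z0 z : cotangent X) : C2ham h ->
  cdom z0.1 z.1 -> differentiable (hloc h z0) (ccoord z0 z).
Proof. by move=> /(_ z0)/Ck_onSE[+ _] dz; apply; exact: ctan_img_ccoord. Qed.

Lemma canonical_symplecticE (z : cotangent X) (V W : 'rV[R]_(mdim X + mdim X)) :
  canonical_symplectic z V W = dot (lsubmx V) (rsubmx W) - dot (rsubmx V) (lsubmx W).
Proof. by rewrite /canonical_symplectic /dot !mxE. Qed.

(** The symplectic form is nondegenerate, so it determines the Hamiltonian vector
    field. *)
Lemma hamiltonian_vfE (h : cotangent X -> R) (z : cotangent X) :
  hamiltonian_vf h z = sgrad (hloc h z) (ccoord z z).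
Proof.
have sP (W : 'rV[R]_(mdim X + mdim X)) :
    canonical_symplectic z (sgrad (hloc h z) (ccoord z z)) W =
    'd (hloc h z) (ccoord z z) W.
  rewrite canonical_symplecticE sgrad_l sgrad_r opprK.
  transitivity ('d (hloc h z) (ccoord z z) (row_mx 0 (rsubmx W) + row_mx (lsubmx W) 0)).
    by rewrite linearD.
  by rewrite add_row_mx addr0 add0r hsubmxK.
rewrite /hamiltonian_vf; case: xgetP => [V _ VP|]; last by move=> /(_ _ sP).
have VP' (W : 'rV[R]_(mdim X + mdim X)) : canonical_symplectic z V W =
    canonical_symplectic z (sgrad (hloc h z) (ccoord z z)) W by rewrite sP; exact: VP.
have dot0 n (a : 'rV[R]_n) : dot a 0 = 0 by rewrite /dot trmx0 mulmx0 mxE.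
rewrite -[LHS](@hsubmxK _ 1 (mdim X) (mdim X)) -[RHS]hsubmxK; congr row_mx.
  apply: dot_inj => w; have := VP' (row_mx 0 w).
  by rewrite !canonical_symplecticE row_mxKl row_mxKr !dot0 !subr0.
apply: dot_inj => w; have := VP' (row_mx w 0).
by rewrite !canonical_symplecticE row_mxKl row_mxKr !dot0 !sub0r => /oppr_inj.
Qed.
End one_manifold.

Section pullback.
Variables (X Y : charted R) (F : X -> Y).
Hypotheses (mX : is_manifold X) (mY : is_manifold Y) (sF : smooth F).

Lemma ccoord_pullback (z0 : cotangent X) (w0 : cotangent Y) (x : X)
  (mu : 'cV[R]_(mdim Y)) :
  cdom z0.1 x -> cdom w0.1 (F x) ->
  ccoord z0 (x, tmap F x *m mu) =
  colift (lmap F z0.1 w0.1) (chart z0.1 x) (rsubmx (ccoord w0 (F x, mu))).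
Proof.
move=> dx dFx; rewrite /ccoord /colift/= row_mxKr; congr row_mx.
by rewrite mulmxA (frame_tmap mX mY sF dx dFx) -trmx_mul mulmxA.
Qed.

(** The coordinate form of the relation between two Hamiltonians that are intertwined
    by the pullback of covectors; it is the hypothesis of [lift_flow]. *)
Lemma hloc_pullback (hM : cotangent X -> R) (hN : cotangent Y -> R) z0 w0 :
  (forall x mu, hM (x, tmap F x *m mu) = hN (F x, mu)) ->
  forall y, ldom F z0.1 w0.1 y -> forall q,
    hloc hM z0 (colift (lmap F z0.1 w0.1) y q) = hloc hN w0
      (row_mx (lmap F z0.1 w0.1 y) q).
Proof.
move=> hMN y /(ldomP (mfd_chartK mX))[dx dFx xK] q.
set x := cinv z0.1 y in dx dFx xK *.
have L : lmap F z0.1 w0.1 y = chart w0.1 (F x) by [].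
set w := copoint w0 (row_mx (lmap F z0.1 w0.1 y) q).
have w1 : w.1 = F x by rewrite /w /copoint/= row_mxKl L (mfd_chartK mY).
have Iw : ctan_img w0.1 (row_mx (lmap F z0.1 w0.1 y) q).
  by rewrite /ctan_img/= row_mxKl L; exact: mem_cimg.
have [_ wK] := copointK mY Iw; rewrite -/w in wK.
have wE : w = (F x, w.2) by rewrite -w1 -surjective_pairing.
have E := ccoord_pullback w.2 dx dFx.
move: E; rewrite -wE wK row_mxKr xK => E.
by rewrite /hloc -E (ccoordK mX)// -/w hMN -wE.
Qed.
End pullback.

Section transition.
Variables (X : charted R) (mX : is_manifold X) (h : cotangent X -> R).
Hypothesis (Ch : C2ham h).

Lemma tmap_id (x : X) : tmap (fun x : X => x) x = 1%:M.
Proof. exact: frame_id. Qed.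

(** Hamilton's equations have the same form in every canonical chart, because the
    changes of charts are pullbacks of covectors: [lift_flow] applies to the
    transition map, from the base chart at [z1] to that at [z0]. *)
Lemma ham_transition (z0 z1 : cotangent X) (c : R -> cotangent X) (t : R) :
  (\forall s \near t, cdom z0.1 (c s).1) -> (\forall s \near t, cdom z1.1 (c s).1) ->
  is_derive t (1 : R) (fun s => ccoord z0 (c s)) (sgrad (hloc h z0) (ccoord z0 (c t))) ->
  is_derive t (1 : R) (fun s => ccoord z1 (c s)) (sgrad (hloc h z1) (ccoord z1 (c t))).
Proof.
move=> d0 d1 dc.
have [XK sX] := (mfd_chartK mX, mfd_compat mX).
have [c0 c1] := (nbhs_singleton d0, nbhs_singleton d1).
pose F := (fun x : X => x).
set P := lmap F z1.1 z0.1.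
pose U := ldom F z1.1 z0.1.
have oU : open U by exact: open_ldom.
have CP : Ck_on 2 U P by exact: Ck_on_lmap.
have I1 : forall y, U y -> forall q, hloc h z1 (colift P y q) = hloc h z0
  (row_mx (P y) q).
  apply: hloc_pullback => // x mu; by rewrite tmap_id mul1mx.
pose x s := chart z1.1 (c s).1.
pose q s := rsubmx (ccoord z0 (c s)).
have xqE s : cdom z0.1 (c s).1 -> cdom z1.1 (c s).1 ->
    colift P (x s) (q s) = ccoord z1 (c s) /\ row_mx (P (x s)) (q s) = ccoord z0 (c s).
  move=> ds0 ds1; split.
    have := @ccoord_pullback X X F mX mX sX z1 z0 (c s).1 (c s).2 ds1 ds0.
    by rewrite tmap_id mul1mx -surjective_pairing.
  by rewrite /P /x lmapE// -[RHS]hsubmxK /q; congr row_mx; rewrite row_mxKl.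
have [E1 E0] := xqE t c0 c1.
have Ux : U (x t) by exact: mem_ldom.
have dH1 : differentiable (hloc h z1) (colift P (x t) (q t)) by rewrite E1;
  exact: diff_hloc.
have dH0 : differentiable (hloc h z0) (row_mx (P (x t)) (q t)) by rewrite E0;
  exact: diff_hloc.
have dq : is_derive t (1 : R) q (rsubmx (sgrad (hloc h z0) (row_mx (P (x t)) (q t)))).
  by rewrite E0; exact: is_derive_rsubmx dc.
have dx : is_derive t (1 : R) x (lsubmx (sgrad (hloc h z1) (colift P (x t) (q t)))).
  (* The two transition maps are inverse to each other. *)
  have JJ := @jacobian_lmap_comp R X X X F F z1.1 z0.1 z1.1 (c t).1 XK XK sX sX c1 c0 c1.
  have J1 := jacobian_lmap_id XK sX c1; move: JJ; rewrite J1 => JJ.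
  have dl := is_derive_lsubmx dc; rewrite -E0 (lift_fiber I1 Ux dH1 dH0) in dl.
  have lE s : lsubmx (ccoord z0 (c s)) = chart z0.1 (c s).1 by rewrite row_mxKl.
  have dL : differentiable (lmap F z0.1 z1.1) (lsubmx (ccoord z0 (c t))).
    by rewrite lE; exact: diff_lmap.
  have D := is_derive_comp dl dL.
  have D' : is_derive t (1 : R) x ('d (lmap F z0.1 z1.1) (lsubmx (ccoord z0 (c t)))
      (lsubmx (sgrad (hloc h z1) (colift P (x t) (q t))) *m 'J P (x t))).
    apply: near_eq_is_derive D; apply: filterS d0 => s ds.
    by rewrite /= lE lmapE.
  apply: (is_derive_eq D').
  apply: etrans (esym (jacobianE _ _ _)) _.
  by rewrite lE -mulmxA -JJ mulmx1.
have [D _] := lift_flow oU CP I1 Ux dH1 dH0 dx dq.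
rewrite -E1; apply: near_eq_is_derive D.
apply: filterS2 d0 d1 => s ds0 ds1; exact: (xqE s ds0 ds1).1.
Qed.
End transition.
End CotangentCharts.

(** * Hamiltonian flows and their projection *)

Section HamiltonianFlow.
Context {R : realType}.
Variables (X : charted R) (mX : is_manifold X) (h : cotangent X -> R).
Hypothesis (Ch : C2ham h).

Lemma near0_near (P : R -> Prop) : (\forall t \near (0 : R), P t) ->
  \forall t \near (0 : R), \forall s \near t, P s.
Proof. by move=> H; exact: (near_join H). Qed.

(** The field and the velocity at time [t] are expressed in the chart at [c t] itself,
    which moves with time; [ham_transition] compares it with the fixed chart. *)
Lemma integral_curve_velocity (z0 : cotangent X) (c : R -> cotangent X) (t : R) :
  (\forall s \near t, cdom z0.1 (c s).1) ->
  is_derive t (1 : R) (fun s => ccoord z0 (c s)) (sgrad (hloc h z0) (ccoord z0 (c t))) ->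
  has_velocity c t (hamiltonian_vf h (c t)).
Proof.
move=> d0 dc; have c0 := nbhs_singleton d0; set zt := c t in c0.
have d1 : \forall s \near t, cdom zt.1 (c s).1.
  have sX := mfd_compat mX.
  have N := near_ldom sX c0 (mfd_mem mX zt.1).
  have lE s : lsubmx (ccoord z0 (c s)) = chart z0.1 (c s).1 by rewrite row_mxKl.
  have dl := is_derive_continuous (is_derive_lsubmx dc).
  have N' : \forall s \near t, ldom (fun x : X => x) z0.1 zt.1 (lsubmx (ccoord z0 (c s))).
    by apply: dl; rewrite lE.
  apply: filterS2 d0 N' => s ds; rewrite lE => /(ldomP (mfd_chartK mX))[_ + _].
  by rewrite (mfd_chartK mX).
split; first exact: d1.
have D := ham_transition mX Ch d0 d1 dc.
exact: is_derive_eq D (esym (hamiltonian_vfE h zt)).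
Qed.

Lemma velocity_coord (z0 : cotangent X) (c : R -> cotangent X) (t : R) :
  (\forall s \near t, cdom z0.1 (c s).1) ->
  has_velocity c t (hamiltonian_vf h (c t)) ->
  is_derive t (1 : R) (fun s => ccoord z0 (c s)) (sgrad (hloc h z0) (ccoord z0 (c t))).
Proof.
move=> d0 [d1 dc].
have dc' : is_derive t (1 : R) (fun s => ccoord (c t) (c s))
  (hamiltonian_vf h (c t) : 'rV[R]_(mdim X + mdim X)) by exact: dc.
by apply: ham_transition (is_derive_eq dc' (hamiltonian_vfE h (c t))).
Qed.

(** A solution of Hamilton's equations in one chart is an integral curve, so the flow
    chosen by [local_flow] is a genuine integral curve; by uniqueness it has the
    germ of the given solution. *)
Theorem hamiltonian_local_flow (z0 : cotangent X) (u : R -> 'rV[R]_(mdim X + mdim X)) :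
  u 0 = ccoord z0 z0 ->
  (\forall t \near (0 : R), is_derive t (1 : R) u (sgrad (hloc h z0) (u t))) ->
  \forall t \near (0 : R), local_flow (hamiltonian_vf h) z0 t = copoint z0 (u t).
Proof.
move=> u0 du.
have Iz := ctan_img_ccoord (mfd_mem mX z0.1).
have oI : open (ctan_img z0.1) by exact: open_ctan_img.
have Iu : \forall t \near (0 : R), ctan_img z0.1 (u t).
  apply: (is_derive_continuous (nbhs_singleton du)).
  by rewrite u0; exact: open_nbhs_nbhs.
pose flow := [set c : R -> {classic (cotangent X)} | c 0 = z0 /\
      exists2 e : R, 0 < e &
        forall t, `|t| < e -> @has_velocity R (cotangent X) c t (hamiltonian_vf h (c t))].
have ex : exists c, flow c.
  exists (fun t => copoint z0 (u t)); split.
    by rewrite u0; apply: ccoordK => //; exact: mfd_mem.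
  have [e e0 eP] := near0_ball (filterI du (near0_near Iu)).
  exists e => // t /eP[dut nI].
  pose c s : cotangent X := copoint z0 (u s).
  have d0 : \forall s \near t, cdom z0.1 (c s).1.
    by apply: filterS nI => s /(copointK mX)[].
  have cE s : ctan_img z0.1 (u s) -> u s = ccoord z0 (c s).
    by move=> /(copointK mX)[_ E]; exact: (esym E).
  have ct := cE _ (nbhs_singleton nI).
  have dc : is_derive t (1 : R) (fun s => ccoord z0 (c s))
    (sgrad (hloc h z0) (ccoord z0 (c t))).
    rewrite -ct; apply: near_eq_is_derive dut.
    by apply: filterS nI => s; exact: cE.
  exact: (integral_curve_velocity d0 dc).
have [c0 [e e0 eP]] := xgetPex (fun=> z0 : {classic (cotangent X)}) ex.
rewrite /local_flow; move: c0 eP; set c := xget _ _ => c0 eP.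
pose c' : R -> cotangent X := c.
have c'0 : c' 0 = z0 by exact: c0.
have dc0 : \forall s \near (0 : R), cdom z0.1 (c' s).1.
  have [] := eP 0 _; first by rewrite normr0.
  by rewrite -/(c' 0) c'0.
have dv : \forall t \near (0 : R), is_derive t (1 : R) (fun s => ccoord z0 (c' s))
    (sgrad (hloc h z0) (ccoord z0 (c' t))).
  have ne : \forall t \near (0 : R), `|t| < e by exact: nbhs0_lt.
  apply: filterS2 ne (near0_near dc0) => t te dct.
  by apply: velocity_coord => //; exact: eP.
have [r [L [r0 L0 _ WL]]] := C1_locally_lipschitz oI Iz (Ck_on_sgrad oI (Ch z0)).
(* In the chart at [z0], the chosen integral curve and [u] solve the same equation. *)
have uv := picard_uniqueness r0 L0 WL u0 (congr1 (ccoord z0) c'0) du dv.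
apply: filterS2 uv dc0 => t E dct.
by rewrite E ccoordK.
Qed.
End HamiltonianFlow.

Section FlowProjection.
Context {R : realType}.

(** Picard's theorem provides, in charts, a curve of base points of [M] and covectors
    of [N] that satisfies the hypotheses of [lift_flow]; the latter yields solutions for
    both Hamiltonians at once, lying over each other, and uniqueness identifies them
    with the two flows. *)
Theorem hamiltonian_flow_projection (M N : charted R) (pi : M -> N)
    (hM : cotangent M -> R) (hN : cotangent N -> R) (m : M) (mu : 'cV[R]_(mdim N)) :
  is_manifold M -> is_manifold N -> smooth pi -> C2ham hM -> C2ham hN ->
  (forall x nu, hM (x, tmap pi x *m nu) = hN (pi x, nu)) ->
  \forall t \near (0 : R),
    pi (local_flow (hamiltonian_vf hM) ((m, tmap pi m *m mu) : cotangent M) t).1 =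
    (local_flow (hamiltonian_vf hN) ((pi m, mu) : cotangent N) t).1.
Proof.
move=> mM mN spi CM CN hMN.
pose zM : cotangent M := (m, tmap pi m *m mu); pose zN : cotangent N := (pi m, mu).
have [MK NK] := (mfd_chartK mM, mfd_chartK mN).
have [dm dn] := (mfd_mem mM m, mfd_mem mN (pi m)).
pose P := lmap pi m (pi m); pose U := ldom pi m (pi m).
pose HM := hloc hM zM; pose HN := hloc hN zN.
have oU : open U by exact: open_ldom.
have CP k : Ck_on k U P by exact: Ck_on_lmap.
have intertwine : forall y, U y -> forall q, HM (colift P y q) = HN (row_mx (P y) q).
  exact: (hloc_pullback (z0 := zM) (w0 := zN) mM mN spi hMN).
have UM y q : U y -> ctan_img m (colift P y q).
  by move=> [x [dx _] <-]; rewrite /ctan_img/= row_mxKl; exact: mem_cimg.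
have UN y q : U y -> ctan_img (pi m) (row_mx (P y) q).
  by move=> [x [dx dpx] <-]; rewrite /ctan_img/= row_mxKl /P lmapE//; exact: mem_cimg.
have oIM : open (ctan_img m) by exact: open_ctan_img.
have oIN : open (ctan_img (pi m)) by exact: open_ctan_img.
have dHM y q : U y -> differentiable HM (colift P y q).
  by move=> Uy; have /Ck_onSE[+ _] := CM zM; apply; exact: UM.
have dHN y q : U y -> differentiable HN (row_mx (P y) q).
  by move=> Uy; have /Ck_onSE[+ _] := CN zN; apply; exact: UN.
pose O := [set w : 'rV[R]_(mdim M + mdim N) | U (lsubmx w)].
have oO : open O by apply: open_comp oU => A _; exact: continuous_lsubmx.
pose WM (w : 'rV[R]_(mdim M + mdim N)) := colift P (lsubmx w) (rsubmx w).
pose WN (w : 'rV[R]_(mdim M + mdim N)) := row_mx (P (lsubmx w)) (rsubmx w).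
(* The mixed equation: base points move by [HM], covectors by [HN]. *)
pose W w : 'rV[R]_(mdim M + mdim N) := row_mx (lsubmx (sgrad HM (WM w)))
  (rsubmx (sgrad HN (WN w))).
have idC : Ck_on 1 O (fun w => w) := @Ck_on_linrV R 1 _ _
  (@idfun 'rV[R]_(mdim M + mdim N) : {linear _ -> _}) O.
have lC := Ck_on_lsubmx oO idC; have rC := Ck_on_rsubmx oO idC.
have WMC : Ck_on 1 O WM := Ck_on_row_mx oO lC (Ck_on_mulmx oO rC (Ck_on_trmx oO
  (Ck_on_comp_mx oO oU (fun w Ow => Ow) lC (Ck_on_jacobian oU (CP 2))))).
have WNC : Ck_on 1 O WN := Ck_on_row_mx oO
  (Ck_on_comp_mx oO oU (fun w Ow => Ow) lC (CP 1)) rC.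
have WC : Ck_on 1 O W := Ck_on_row_mx oO
  (Ck_on_lsubmx oO (Ck_on_comp_mx oO oIM (fun w Ow => UM _ _ Ow) WMC
    (Ck_on_sgrad oIM (CM zM))))
  (Ck_on_rsubmx oO (Ck_on_comp_mx oO oIN (fun w Ow => UN _ _ Ow) WNC
    (Ck_on_sgrad oIN (CN zN)))).
pose w0 : 'rV[R]_(mdim M + mdim N) := row_mx (chart m m) (rsubmx (ccoord zN zN)).
have Ow0 : O w0 by rewrite /O/= row_mxKl; exact: mem_ldom.
have [r [L [r0 L0 rO WL]]] := C1_locally_lipschitz oO Ow0 WC.
have [d d0 [w [w00 wP]]] := picard_existence r0 L0 WL.
have sol (t : R) : `|t| < d -> [/\ U (lsubmx (w t)),
    is_derive t (1 : R) (fun s => WM (w s)) (sgrad HM (WM (w t))) &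
    is_derive t (1 : R) (fun s => WN (w s)) (sgrad HN (WN (w t)))].
  move=> /wP[/rO Uw dw].
  have dl := is_derive_lsubmx dw; have dr := is_derive_rsubmx dw.
  rewrite row_mxKl in dl; rewrite row_mxKr in dr.
  have [D1 D2] := lift_flow (x := fun s => lsubmx (w s)) (q := fun s => rsubmx (w s))
    oU (CP 2) intertwine Uw (dHM _ _ Uw) (dHN _ _ Uw) dl dr.
  by split.
have M0 : WM (w 0) = ccoord zM zM.
  rewrite /WM w00 row_mxKl row_mxKr.
  exact: esym (ccoord_pullback (z0 := zM) (w0 := zN) mM mN spi mu dm dn).
have N0 : WN (w 0) = ccoord zN zN.
  by rewrite /WN w00 row_mxKl row_mxKr /P lmapE// -[RHS]hsubmxK row_mxKl.
have FM := hamiltonian_local_flow mM CM M0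
  (ball_near0 d0 (fun t td => let: And3 _ H _ := sol t td in H)).
have FN := hamiltonian_local_flow mN CN N0
  (ball_near0 d0 (fun t td => let: And3 _ _ H := sol t td in H)).
have FU : \forall t \near (0 : R), U (lsubmx (w t)) :=
  ball_near0 d0 (fun t td => let: And3 H _ _ := sol t td in H).
apply: filterS3 FM FN FU => t EM EN Uw.
rewrite -/zM -/zN EM EN /copoint/= !row_mxKl.
by have [_ dpx _] := ldomP MK Uw; rewrite /P /lmap/= NK.
Qed.
End FlowProjection.

(** * Smooth maps and sections *)

Section SmoothMaps.
Context {R : realType}.

Lemma open_preimage (V W : topologicalType) (D : set V) (E : set W) (f : V -> W) :
  open D -> open E -> (forall x, D x -> {for x, continuous f}) ->
  open (D `&` f @^-1` E).
Proof.
move=> oD oE cf; rewrite openE => x [Dx Ex]; apply: filterI.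
  exact: open_nbhs_nbhs.
by apply: (cf x Dx); exact: open_nbhs_nbhs.
Qed.

Lemma open_local (V : topologicalType) (U : set V) :
  (forall x, U x -> exists U', [/\ open U', U' x & U' `<=` U]) -> open U.
Proof.
move=> H; rewrite openE => x /H[U' [oU' U'x U'U]].
by apply: filterS U'U _; exact: open_nbhs_nbhs.
Qed.

Lemma smooth_comp (X Y Z : charted R) (F : X -> Y) (G : Y -> Z) :
  is_manifold X -> is_manifold Y ->
  smooth F -> smooth G -> smooth (G \o F).
Proof.
move=> mX mY sF sG x0 w0.
have [XK YK] := (mfd_chartK mX, mfd_chartK mY).
(* An intermediate chart of [Y] is chosen around each point. *)
pose V y0 := ldom F x0 y0 `&` lmap F x0 y0 @^-1` ldom G y0 w0.
have oV y0 : open (V y0).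
  apply: open_preimage; [exact: open_ldom|exact: open_ldom|].
  exact: Ck_on_cont (Ck_on_lmap x0 y0 0 sF).
have VP y0 u : V y0 u -> [/\ cdom x0 (cinv x0 u), cdom y0 (F (cinv x0 u)),
    cdom w0 (G (F (cinv x0 u))) & chart x0 (cinv x0 u) = u].
  move=> [/(ldomP XK)[dx dFx xK]] [y [dy dGy] yE].
  have yF : y = F (cinv x0 u) by rewrite -(YK _ _ dFx)
    -[RHS](_ : cinv y0 (lmap F x0 y0 u) = _)// -yE YK.
  by split=> //; rewrite -yF.
have cover u : ldom (G \o F) x0 w0 u -> V (F (cinv x0 u)) u.
  move=> [x [dx dGx] <-]; rewrite XK//; split.
    by apply: mem_ldom => //; exact: mfd_mem.
  rewrite /preimage/= lmapE//; apply: mem_ldom => //; exact: mfd_mem.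
have oU : open (ldom (G \o F) x0 w0).
  apply: open_local => u /cover Vu; exists (V (F (cinv x0 u))); split=> //.
  by move=> v /VP[dx _ dGx <-]; exact: mem_ldom.
split=> // k; apply: Ck_on_local => u /cover Vu; set y0 := F _ in Vu.
exists (V y0) => //.
have VG v : V y0 v -> ldom G y0 w0 (lmap F x0 y0 v) by case.
have CF : Ck_on k (V y0) (lmap F x0 y0).
  by apply: Ck_on_sub (Ck_on_lmap x0 y0 k sF) => v [].
have C := Ck_on_comp_mx (oV y0) (open_ldom (x0 := y0) (y0 := w0) sG) VG CF
  (Ck_on_lmap y0 w0 k sG).
apply: Ck_on_ext (oV y0) _ C => v /VP[dx dFx _ _].
by rewrite /= /lmap/= YK.
Qed.

Lemma Ck_on_slice k n p (U : set 'rV[R]_n) (c : 'rV[R]_p) : open U ->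
  Ck_on k U (fun v : 'rV[R]_n => row_mx v c).
Proof.
move=> oU; apply: Ck_on_row_mx => //; last exact: Ck_on_cst.
exact: (@Ck_on_linrV R k _ _ (@idfun 'rV[R]_n : {linear _ -> _})).
Qed.

Lemma open_slice n p (c : 'rV[R]_p) (U : set 'rV[R]_(n + p)) : open U ->
  open [set v : 'rV[R]_n | U (row_mx v c)].
Proof.
move=> oU; apply: open_comp oU => v _.
exact: (@Ck_on_slice 0 n p setT c openT v I).
Qed.

Lemma smooth_slice (X Y Z : charted R) (f : X -> Y -> Z) (y : Y) :
  is_manifold Y -> smooth (fun p : product X Y => f p.1 p.2) -> smooth (f^~ y).
Proof.
move=> mY sf x0 z0; have YK := mfd_chartK mY; have dy := mfd_mem mY y.
pose p0 : product X Y := (x0, y).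
pose U : set 'rV[R]_(mdim X + mdim Y) := chart p0 @`
  (cdom p0 `&` (fun p : product X Y => f p.1 p.2) @^-1` cdom z0).
have [oU CU] := sf p0 z0.
have E : chart x0 @` (cdom x0 `&` (f^~ y) @^-1` cdom z0) =
  [set v | U (row_mx v (chart y y))].
  rewrite eqEsubset; split=> v.
    by move=> [x [dx dfx] <-]; exists (x, y).
  move=> [[x y'] [[dx dy'] dfx]] /= /eq_row_mx[<- /= cy].
  exists x => //; split=> //=; rewrite /preimage/=.
  by rewrite -(YK _ _ dy) -cy YK.
have oV : open (chart x0 @` (cdom x0 `&` (f^~ y) @^-1` cdom z0)).
  by rewrite E; exact: open_slice.
split=> // k.
pose g : 'rV[R]_(mdim X + mdim Y) -> 'rV[R]_(mdim Z) :=
  chart z0 \o (fun p : product X Y => f p.1 p.2) \o cinv p0.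
have C : Ck_on k (chart x0 @` (cdom x0 `&` (f^~ y) @^-1` cdom z0))
  (g \o (fun v => row_mx v (chart y y))).
  apply: (Ck_on_comp_mx oV (oU : open U) _ (Ck_on_slice k _ oV) (CU k)).
  by move=> v; rewrite E.
apply: Ck_on_ext oV _ C => v _.
by rewrite /g/= row_mxKl row_mxKr YK.
Qed.

Lemma smooth_section (X Y : charted R) (Phi : cotangent X -> cotangent Y) :
  is_manifold X -> smooth Phi -> smooth (fun x => (Phi (x, 0)).1).
Proof.
move=> mX sP x0 y0.
pose z0 : cotangent X := (x0, 0); pose w0 : cotangent Y := (y0, 0).
pose U : set 'rV[R]_(mdim X + mdim X) := chart z0 @` (cdom z0 `&` Phi @^-1` cdom w0).
have [oU CU] := sP z0 w0.
pose s := fun x : X => (Phi (x, 0)).1.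
have E : chart x0 @` (cdom x0 `&` s @^-1` cdom y0) = [set v | U (row_mx v 0)].
  rewrite eqEsubset; split=> v.
    move=> [x [dx dsx] <-]; exists (x, 0) => //=; by rewrite mulmx0 trmx0.
  move=> [[x nu] [dx dPx]] /= /eq_row_mx[<- fnu].
  exists x => //; split=> //; rewrite /s /preimage/=.
  suff -> : (0 : 'cV[R]_(mdim X)) = nu by [].
  have fu : frame x0 x \in unitmx by exact: frame_unit.
  have f0 : frame x0 x *m nu = 0 by apply: trmx_inj; rewrite fnu trmx0.
  by rewrite -(mulKmx fu nu) f0 mulmx0.
have oV : open (chart x0 @` (cdom x0 `&` s @^-1` cdom y0)) by rewrite E;
  exact: open_slice.
split=> // k.
pose g : 'rV[R]_(mdim X + mdim X) -> 'rV[R]_(mdim Y + mdim Y) :=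
  chart w0 \o Phi \o cinv z0.
have C : Ck_on k (chart x0 @` (cdom x0 `&` s @^-1` cdom y0)) (g \o (fun v => row_mx v 0)).
  apply: (Ck_on_comp_mx oV (oU : open U) _ (Ck_on_slice k _ oV) (CU k)).
  by move=> v; rewrite E.
apply: Ck_on_ext oV _ (Ck_on_lsubmx oV C) => v _.
by rewrite /g/= row_mxKl row_mxKl row_mxKr trmx0 mulmx0.
Qed.

Lemma C2ham_pullback (X Y : charted R) (Phi : cotangent X -> cotangent Y)
    (hX : cotangent X -> R) (hY : cotangent Y -> R) :
  is_manifold X -> is_manifold Y -> smooth Phi -> (forall z, hX z = hY (Phi z)) ->
  C2ham hY -> C2ham hX.
Proof.
move=> mX mY sP hE CY z0; apply: Ck_on_local => u Iu.
have [du cK] := copointK mX Iu; pose w := Phi (copoint z0 u).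
pose U : set 'rV[R]_(mdim X + mdim X) := chart z0 @` (cdom z0 `&` Phi @^-1` cdom w).
have [oU CU] := sP z0 w.
pose g : 'rV[R]_(mdim X + mdim X) -> 'rV[R]_(mdim Y + mdim Y) :=
  chart w \o Phi \o cinv z0.
have UP v : U v -> copoint w (g v) = Phi (copoint z0 v) /\ ctan_img w.1 (g v).
  move=> [z [dz dPz] <-].
  have zK : copoint z0 (ccoord z0 z) = z by exact: ccoordK.
  have gE : g (ccoord z0 z) = ccoord w (Phi z).
    by rewrite -[LHS]/(ccoord w (Phi (copoint z0 (ccoord z0 z)))) zK.
  rewrite -[chart z0 z]/(ccoord z0 z) gE zK; split; last exact: ctan_img_ccoord.
  exact: ccoordK.
exists U; first by exists (copoint z0 u) => //; split=> //; exact: (mfd_mem mY).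
have C : Ck_on 2 U (hloc hY w \o g) := @Ck_on_comp R _ _ R 2 U _ g (hloc hY w) oU
  (fun v Uv => (UP v Uv).2) (CU 2) (CY w).
apply: Ck_on_ext (oU : open U) _ C => v /UP[E _].
by rewrite /= /hloc E hE.
Qed.
End SmoothMaps.

(** * The Hamiltonian of a horizontal distribution *)

Section HorizontalProjection.
Context {R : realType} {d e : nat}.
Variables (G : 'M[R]_d) (T : 'M[R]_(d, e)).
Hypotheses (Gsym : G^T = G)
  (Gpos : forall v : 'rV[R]_d, v != 0 -> 0 < (v *m G *m v^T) ord0 ord0)
  (Tfull : row_full T).

Definition dual_gram_inv := invmx (T^T *m invmx G *m T).

(** The transpose of [T nu], followed by [invmx G], describes all vectors that are
    [G]-orthogonal to the kernel of [T]; solving for [nu] gives this explicit formula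
    for the restricted sharp map, from which its smoothness is visible. *)
Definition hsharp (p : 'cV[R]_d) : 'rV[R]_d :=
  (invmx G *m T *m dual_gram_inv *m T^T *m invmx G *m p)^T.

Lemma gram_unit : G \in unitmx.
Proof.
rewrite -row_free_unit; apply/row_freeP; apply: contrapT => nG.
have : kermx G != 0.
  by apply/negP => /eqP k0; apply: nG; apply/row_freeP; rewrite -kermx_eq0 k0.
case/rowV0Pn => v /sub_kermxP vG v0.
by have := Gpos v0; rewrite vG mul0mx mxE ltxx.
Qed.

Lemma invG_sym : (invmx G)^T = invmx G.
Proof. by rewrite trmx_inv Gsym. Qed.

(** A matrix of full column rank pulls the positive definite form [invmx G] back to a
    positive definite form. *)
Lemma dual_gram_unit : T^T *m invmx G *m T \in unitmx.
Proof.
rewrite -row_free_unit -kermx_eq0; apply/negPn/negP => /rowV0Pn[y /sub_kermxP yQ].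
apply/negP/negPn; set a := y *m T^T.
have a0 : a *m invmx G = 0.
  apply/eqP; apply: contraT => /Gpos.
  rewrite trmx_mul invG_sym mulmxA mulmxKV ?gram_unit//.
  rewrite /a trmx_mul trmxK.
  have -> : y *m T^T *m invmx G *m (T *m y^T) = y *m (T^T *m invmx G *m T) *m y^T.
    by rewrite !mulmxA.
  by rewrite yQ mul0mx mxE ltxx.
have : a = 0 by rewrite -(mulmxKV gram_unit a) a0 mul0mx.
move=> /eqP; rewrite /a mulmx_free_eq0//.
by rewrite /row_free mxrank_tr.
Qed.

Lemma hsharp_horizontal p (k : 'rV[R]_d) : k *m T = 0 -> hsharp p *m G *m k^T = 0.
Proof.
move=> kT; apply: trmx_inj; rewrite /hsharp !trmx_mul !trmxK trmx0 Gsym !mulmxA.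
by rewrite mulmxK ?gram_unit// kT !mul0mx.
Qed.

(** Subtracting from [w] its orthogonal projection [h] leaves a vector that lies in
    the kernel of [T] and is orthogonal to it; hence [w = h], on which the formula
    for [hsharp] can be checked. *)
Lemma hsharp_repr p (w : 'rV[R]_d) :
  (forall k : 'rV[R]_d, k *m T = 0 -> w *m G *m k^T = 0) ->
  w *m p = hsharp p *m G *m w^T.
Proof.
move=> wh.
set h := w *m T *m dual_gram_inv *m T^T *m invmx G.
have kT : (w - h) *m T = 0.
  have -> : (w - h) *m T = w *m T - w *m T *m (dual_gram_inv *m (T^T *m invmx G *m T)).
    by rewrite mulmxBl /h !mulmxA.
  by rewrite /dual_gram_inv mulVmx ?dual_gram_unit// mulmx1 subrr.
have hh : h *m G *m (w - h)^T = 0.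
  apply: trmx_inj; rewrite trmx0 trmx_mul trmxK trmx_mul Gsym /h !trmx_mul trmxK invG_sym.
  by rewrite !mulmxA mulmxK ?gram_unit// kT !mul0mx.
have k0 : w - h = 0.
  apply/eqP; apply: contraT => /Gpos.
  by rewrite mulmxBl mulmxBl wh// hh subrr mxE ltxx.
have wE : w = h by apply/eqP; rewrite -subr_eq0 k0.
have E : (hsharp p *m G *m w^T)^T = w *m p.
  rewrite !trmx_mul trmxK Gsym /hsharp trmxK !mulmxA mulmxK ?gram_unit//.
  by rewrite -/h -wE.
by rewrite -E; apply/matrixP => i j; rewrite mxE !ord1.
Qed.
End HorizontalProjection.

Section SubRiemannian.
Context {R : realType}.
Implicit Types X : charted R.

Lemma innerBl X g (x : X) u v w : inner g x (u - v) w = inner g x u w - inner g x v w.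
Proof. by rewrite /inner !mulmxBl !mxE. Qed.

Lemma pairingE X (lam : 'cV[R]_(mdim X)) (v : 'rV[R]_(mdim X)) (A : 'M[R]_1) :
  v *m lam = A -> pairing lam v = A ord0 ord0.
Proof. by rewrite /pairing => ->. Qed.

Lemma horizontalB X (Y : charted R) g (F : X -> Y) x v w :
  horizontal g F x v -> horizontal g F x w -> horizontal g F x (v - w).
Proof. by move=> hv hw k kT; rewrite innerBl hv// hw// subr0. Qed.

Lemma sharpE X (D : X -> set 'rV[R]_(mdim X)) g x lam v :
  (forall v, v != 0 -> 0 < inner g x v v) ->
  (forall v w, D x v -> D x w -> D x (v - w)) ->
  D x v -> (forall w, D x w -> pairing lam w = inner g x v w) ->
  sharp D g x lam = v.
Proof.
move=> gpos DB Dv vP; rewrite /sharp; case: xgetP => [u _ [Du uP]|/(_ v)[]//].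
apply/eqP; rewrite -subr_eq0; apply: contraT => /gpos.
have Duv := DB _ _ Du Dv.
by rewrite innerBl -(uP _ Duv) -(vP _ Duv) subrr ltxx.
Qed.

Section horizontal.
Variables (X Y : charted R) (F : X -> Y) (g : X -> 'M[R]_(mdim X)).
Hypotheses (mX : is_manifold X) (mY : is_manifold Y) (sF : smooth F)
  (rg : riemannian g) (subF : forall x, row_full (tmap F x)).

Definition gram (x0 x : X) : 'M[R]_(mdim X) := frame x0 x *m g x *m (frame x0 x)^T.

Lemma metric_sym x : (g x)^T = g x.
Proof.
apply/matrixP => i j; rewrite mxE.
have := riem_sym rg x (delta_mx 0 j) (delta_mx 0 i).
by rewrite /inner !trmx_delta -!rowE -!colE !mxE.
Qed.

Lemma gram_sym x0 x : (gram x0 x)^T = gram x0 x.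
Proof. by rewrite /gram !trmx_mul trmxK metric_sym mulmxA. Qed.

Lemma gram_pos x0 x : cdom x0 x ->
  forall v : 'rV[R]_(mdim X), v != 0 -> 0 < (v *m gram x0 x *m v^T) ord0 ord0.
Proof.
move=> dx v v0; have fu := frame_unit mX dx.
have vf : v *m frame x0 x != 0.
  by apply: contra v0 => /eqP vf; rewrite -(mulmxK fu v) vf mul0mx.
by have := riem_pos rg x vf; rewrite /inner /gram trmx_mul !mulmxA.
Qed.

Lemma lmap_row_full x0 y0 x : cdom x0 x -> cdom y0 (F x) ->
  row_full ('J (lmap F x0 y0) (chart x0 x)).
Proof.
move=> dx dFx.
have E := frame_tmap mX mY sF dx dFx.
have fu := frame_unit mX dx; have fu' := frame_unit mY dFx.
rewrite /row_full -(mxrankMfree _ (_ : row_free (frame y0 (F x)))) ?row_free_unit//.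
rewrite -E (eqmxMfull (tmap F x) (_ : row_full (frame x0 x))) ?row_full_unit//.
exact: subF.
Qed.

Section at_point.
Variables (x0 x : X) (y0 : Y).
Hypotheses (dx : cdom x0 x) (dFx : cdom y0 (F x)).
Let fr := frame x0 x.
Let T := 'J (lmap F x0 y0) (chart x0 x).

Lemma inner_frame (a b : 'rV[R]_(mdim X)) :
  inner g x (a *m fr) (b *m fr) = (a *m gram x0 x *m b^T) ord0 ord0.
Proof. by rewrite /inner /gram trmx_mul !mulmxA. Qed.

Lemma tmap_frame0 (a : 'rV[R]_(mdim X)) : a *m fr *m tmap F x = 0 <-> a *m T = 0.
Proof.
have E := frame_tmap mX mY sF dx dFx.
rewrite -mulmxA E mulmxA; split=> [aT|->]; last by rewrite mul0mx.
by rewrite -(mulmxK (frame_unit mY dFx) (a *m T)) aT mul0mx.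
Qed.

Definition loc_sharp (lam : 'cV[R]_(mdim X)) : 'rV[R]_(mdim X) :=
  hsharp (gram x0 x) T (fr *m lam) *m fr.

Lemma loc_sharpP lam : horizontal g F x (loc_sharp lam) /\
  forall w, horizontal g F x w -> pairing lam w = inner g x (loc_sharp lam) w.
Proof.
have fu := frame_unit mX dx.
have [Gs Gp Tf] := And3 (gram_sym x0 x) (gram_pos dx) (lmap_row_full dx dFx).
have frK (w : 'rV[R]_(mdim X)) : w = w *m invmx fr *m fr by rewrite mulmxKV.
split=> [w|w hw].
  rewrite {1}(frK w) => /tmap_frame0 wT.
  by rewrite (frK w) inner_frame hsharp_horizontal// mxE.
rewrite (frK w) inner_frame; apply: pairingE.
have HR (k : 'rV[R]_(mdim X)) : k *m T = 0 -> w *m invmx fr *m gram x0 x *m k^T = 0.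
  move=> kT; have /hw : k *m fr *m tmap F x = 0 by apply/tmap_frame0.
  rewrite {1}(frK w) inner_frame => H; apply/matrixP => i j.
  by rewrite !ord1 H mxE.
by rewrite -mulmxA; exact: (hsharp_repr Gs Gp Tf (fr *m lam) HR).
Qed.

Lemma sharp_horizontal lam : sharp (horizontal g F) g x lam = loc_sharp lam.
Proof.
have [H1 H2] := loc_sharpP lam.
apply: sharpE => //; first exact: riem_pos.
by move=> v w; exact: horizontalB.
Qed.

Lemma sR_hamiltonian_loc lam : sR_hamiltonian (horizontal g F) g (x, lam) =
  2^-1 * (hsharp (gram x0 x) T (fr *m lam) *m (fr *m lam)) ord0 ord0.
Proof.
have [H1 H2] := loc_sharpP lam.
rewrite /sR_hamiltonian /cometric/= sharp_horizontal -H2//.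
by rewrite /pairing /loc_sharp mulmxA.
Qed.
End at_point.

Lemma gram_Ck k x0 : Ck_on k (cimg x0) (fun u => gram x0 (cinv x0 u)).
Proof. exact: riem_smooth rg x0 k. Qed.

(** In charts, the Hamiltonian is a quadratic form in the momentum whose coefficients
    are rational functions of those of the metric and of the differential of [F]. *)
Lemma C2ham_sR : C2ham (sR_hamiltonian (horizontal g F) g).
Proof.
move=> z0; apply: Ck_on_local => u0 Iu0.
have XK := mfd_chartK mX.
have [du0 uK0] := cimgP XK Iu0.
pose x1 := cinv z0.1 (lsubmx u0); pose y0 := F x1.
pose D := ldom F z0.1 y0.
pose U := [set u : 'rV[R]_(mdim X + mdim X) | D (lsubmx u)].
have Uu0 : U u0 by rewrite /U /D /= -uK0; apply: mem_ldom => //; exact: mfd_mem.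
have oD : open D by exact: open_ldom.
have oU : open U by apply: open_comp oD => A _; exact: continuous_lsubmx.
exists U => //.
pose Gu (u : 'rV[R]_(mdim X + mdim X)) := gram z0.1 (cinv z0.1 (lsubmx u)).
pose Tu (u : 'rV[R]_(mdim X + mdim X)) := 'J (lmap F z0.1 y0) (lsubmx u).
pose f u := 2^-1 * (hsharp (Gu u) (Tu u) (rsubmx u)^T *m (rsubmx u)^T) ord0 ord0.
have UP u : U u -> [/\ cdom z0.1 (cinv z0.1 (lsubmx u)),
  cdom y0 (F (cinv z0.1 (lsubmx u)))
    & chart z0.1 (cinv z0.1 (lsubmx u)) = lsubmx u] by move=> /(ldomP XK).
apply: (@Ck_on_ext _ _ _ 2 U f) => //.
  move=> u /UP[dx dFx uK].
  have Iu : ctan_img z0.1 u by rewrite /ctan_img/= -uK; exact: mem_cimg.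
  have [_ cK] := copointK mX Iu.
  rewrite /hloc (surjective_pairing (copoint z0 u)) (sR_hamiltonian_loc dx dFx) uK.
  have E : (rsubmx u)^T = frame z0.1 (copoint z0 u).1 *m (copoint z0 u).2.
    by rewrite -{1}cK row_mxKr trmxK.
  by rewrite /f E.
have idC : Ck_on 2 U (fun u : 'rV[R]_(mdim X + mdim X) => u).
  exact: (@Ck_on_linrV R 2 _ _ (@idfun 'rV[R]_(mdim X + mdim X) : {linear _ -> _})).
have lC := Ck_on_lsubmx oU idC.
have pC := Ck_on_trmx oU (Ck_on_rsubmx oU idC).
have DI : D `<=` cimg z0.1 by move=> _ [x [dx _] <-]; exact: mem_cimg.
have GC : Ck_on 2 U Gu := Ck_on_comp_mx oU oD (fun u Uu => Uu) lC
  (Ck_on_sub DI (gram_Ck 2 z0.1)).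
have TC : Ck_on 2 U Tu :=
  Ck_on_comp_mx oU oD (fun u Uu => Uu) lC (Ck_on_jacobian oD (Ck_on_lmap z0.1 y0 3 sF)).
have iC : Ck_on 2 U (fun u => invmx (Gu u)).
  by apply: (Ck_on_invmx oU _ GC) => u /UP[dx _ _]; exact: gram_unit (gram_pos dx).
have tC := Ck_on_trmx oU TC.
have hC : Ck_on 2 U (fun u => dual_gram_inv (Gu u) (Tu u)).
  apply: (Ck_on_invmx oU _ (Ck_on_mulmx oU (Ck_on_mulmx oU tC iC) TC)).
  move=> u /UP[dx dFx uK]; apply: dual_gram_unit; [exact: gram_sym|exact: gram_pos|].
  by rewrite /Tu -uK; exact: lmap_row_full.
have sC : Ck_on 2 U (fun u => hsharp (Gu u) (Tu u) (rsubmx u)^T) :=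
  Ck_on_trmx oU (Ck_on_mulmx oU (Ck_on_mulmx oU (Ck_on_mulmx oU (Ck_on_mulmx oU
    (Ck_on_mulmx oU iC TC) hC) tC) iC) pC).
exact: (Ck_onM oU (Ck_on_cst 2 U _) (Ck_on_entry ord0 ord0 oU (Ck_on_mulmx oU sC pC))).
Qed.
End horizontal.
End SubRiemannian.

(** * Nested principal bundles *)

Section NestedBundle.
Context {R : realType}.

Lemma lg_mulgV (H : lie_group R) (h : H) : lg_mul h (lg_inv h) = lg_one H.
Proof.
rewrite -[LHS]lg_mul1g -{1}(lg_mulVg (lg_inv h)) -lg_mulA (lg_mulA (lg_inv h)).
by rewrite lg_mulVg lg_mul1g lg_mulVg.
Qed.

Section horizontal_invariance.
Variables (H : lie_group R) (M N : charted R) (act : M -> H -> M) (pi : M -> N)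
  (g : M -> 'M[R]_(mdim M)).
Hypotheses (pb : principal_bundle pi act) (g_inv : invariant_metric act g).

Lemma smooth_act h : smooth (act^~ h).
Proof. exact: smooth_slice (lg_manifold H) (pb_act_smooth pb). Qed.

Lemma actK h : act^~ (lg_inv h) \o act^~ h = id.
Proof.
by apply/funext => x; rewrite /= (pb_actM pb) lg_mulgV (pb_act1 pb).
Qed.

Lemma actVK h : act^~ h \o act^~ (lg_inv h) = id.
Proof.
by apply/funext => x; rewrite /= (pb_actM pb) lg_mulVg (pb_act1 pb).
Qed.

Lemma pi_act h : pi \o act^~ h = pi.
Proof.
by apply/funext => x; rewrite /=; apply/esym/(pb_fiber pb); exists h.
Qed.

(** The action preserves the metric and, as it preserves the fibers, the vertical
    space; hence it preserves the orthogonal complement. *)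
Lemma horizontal_act h x v : horizontal g pi x v ->
  horizontal g pi (act x h) (v *m tmap (act^~ h) x).
Proof.
have mM := pb_total pb; have mN := pb_base pb; have sa := smooth_act h.
move=> hv w wT.
pose b := act^~ (lg_inv h); have sb : smooth b by exact: smooth_act.
have bK : b (act x h) = x by exact: (congr1 (@^~ x) (actK h)).
have E1 : tmap b (act x h) *m tmap (act^~ h) x = 1%:M.
  rewrite -[in tmap (act^~ h) _]bK -(tmap_comp mM mM mM _ sb sa) actVK.
  exact: tmap_id.
have wE : w = w *m tmap b (act x h) *m tmap (act^~ h) x by rewrite -mulmxA E1 mulmx1.
rewrite wE g_inv; apply: hv.
have E2 : tmap pi x = tmap (act^~ h) x *m tmap pi (act x h).
  by rewrite -(tmap_comp mM mM mN _ sa (pb_smooth pb)) (pi_act h).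
by rewrite [tmap pi x]E2 mulmxA -wE.
Qed.
End horizontal_invariance.

Section nested.
Variables (H K : lie_group R) (M NH NK : charted R) (iota : K -> H)
  (act : M -> H -> M) (piH : M -> NH) (piK : M -> NK).
Hypotheses (nested : nested_principal_bundle iota act piH piK).
Variables (g : M -> 'M[R]_(mdim M)) (gK : NK -> 'M[R]_(mdim NK)).
Hypotheses (g_riem : riemannian g) (g_inv : invariant_metric act g)
  (gK_quot : quotient_metric piK g gK).
Variables (s : NK -> M).
Hypotheses (smooth_s : smooth s) (sK : forall n, piK (s n) = n).

Let DH := horizontal g piH.
Let D := pushforward piK DH.
Let pbH := nested_H nested.
Let pbK := nested_K nested.
Let mM := pb_total pbH.
Let mNH := pb_base pbH.
Let mNK := pb_base pbK.

(** A section [s] of [piK] factors [piH] as [(piH \o s) \o piK]. *)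
Lemma vertical_sub x (v : 'rV[R]_(mdim M)) : v *m tmap piK x = 0 -> v *m tmap piH x = 0.
Proof.
have sp : smooth (piH \o s) by exact: smooth_comp mNK mM smooth_s (pb_smooth pbH).
have piE : piH = (piH \o s) \o piK.
  apply/funext => m; rewrite /=; apply/(pb_fiber pbH).
  have /(pb_fiber pbK)[k ->] : piK m = piK (s (piK m)) by rewrite sK.
  by exists (iota k).
have E : tmap piH x = tmap piK x *m tmap (piH \o s) (piK x).
  by rewrite -(tmap_comp mM mNK mNH _ (pb_smooth pbK) sp) -piE.
by move=> vK; rewrite [tmap piH x]E mulmxA vK mul0mx.
Qed.

Lemma DH_horizontalK x v : DH x v -> horizontal g piK x v.
Proof. by move=> hv w /vertical_sub; exact: hv. Qed.

(** The distribution at [piK x] is a union over the fiber of [x]; by invariance under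
    [K], every point of the fiber contributes the same subspace. *)
Lemma pushforward_fiber x w : D (piK x) w -> exists2 v, DH x v & w = v *m tmap piK x.
Proof.
move=> [y [v [/(pb_fiber pbK)[k ->] hv ->]]].
have sa := smooth_act pbH (iota k).
exists (v *m tmap (act^~ (iota k)) y); first exact: horizontal_act.
rewrite -mulmxA; congr (_ *m _).
rewrite -(tmap_comp mM mM mNK _ sa (pb_smooth pbK)).
by rewrite (pi_act pbK k).
Qed.

(** [piK] maps the horizontal space of [piH] at [x] isometrically onto the
    distribution at [piK x], hence it commutes with the sharp maps. *)
Lemma sR_hamiltonian_pullback x (nu : 'cV[R]_(mdim NK)) :
  sR_hamiltonian DH g (x, tmap piK x *m nu) = sR_hamiltonian D gK (piK x, nu).
Proof.
have [gKr gKE] := gK_quot.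
have [dx dHx] := (mfd_mem mM x, mfd_mem mNH (piH x)).
have [hv vP] := loc_sharpP mM mNH (pb_smooth pbH) g_riem (pb_submersion pbH) dx dHx
  (tmap piK x *m nu).
have vE := sharp_horizontal mM mNH (pb_smooth pbH) g_riem (pb_submersion pbH) dx dHx
  (tmap piK x *m nu).
move: vE hv vP; set v := loc_sharp _ _ _ _ _ _ => vE hv vP.
have isoK a b : DH x a -> DH x b ->
    inner g x a b = inner gK (piK x) (a *m tmap piK x) (b *m tmap piK x).
  by move=> ha hb; apply: gKE; exact: DH_horizontalK.
have Dim a : DH x a -> D (piK x) (a *m tmap piK x) by move=> ha; exists x, a.
have wE : sharp D gK (piK x) nu = v *m tmap piK x.
  apply: sharpE; first exact: riem_pos.
  - move=> a b /pushforward_fiber[a' ha ->] /pushforward_fiber[b' hb ->].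
    by rewrite -mulmxBl; apply: Dim; exact: horizontalB.
  - exact: Dim.
  - move=> w /pushforward_fiber[w' hw ->]; rewrite -isoK// -vP//.
    by rewrite /pairing mulmxA.
by rewrite /sR_hamiltonian /cometric/= vE wE -isoK.
Qed.
End nested.
End NestedBundle.

(** * Projection of geodesics *)

Theorem theorem1 (R : realType) (H K : lie_group R) (M NH NK : charted R)
    (iota : K -> H) (act : M -> H -> M) (piH : M -> NH) (piK : M -> NK)
    (nested : nested_principal_bundle iota act piH piK)
    (g : M -> 'M[R]_(mdim M)) (g_riem : riemannian g)
    (g_inv : invariant_metric act g)
    (I_const : forall (m m' : M) (xi eta : 'rV[R]_(mdim H)),
       orbit_form act g m xi eta = orbit_form act g m' xi eta)
    (gK : NK -> 'M[R]_(mdim NK)) (gK_quot : quotient_metric piK g gK)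
    (piKstar : cotangent NK -> cotangent M)
    (piKstar_pull : pullback_map piK piKstar)
    (piKstar_symp : symplectic_map piKstar)
    (n : NK) (mu : 'cV[R]_(mdim NK)) (m : M) (lam : 'cV[R]_(mdim M))
    (mlam : piKstar (n, mu) = (m, lam)) :
  let DH := horizontal g piH in
  let D := pushforward piK DH in
  \forall t \near 0^'+,
    piK (sR_geodesic DH g m lam t) = sR_geodesic D gK n mu t.
Proof.
move=> DH D.
have [smooth_star starP] := piKstar_pull.
have [pbH pbK] := (nested_H nested, nested_K nested).
have [mM mNH mNK] := And3 (pb_total pbH) (pb_base pbH) (pb_base pbK).
(* The zero covectors give a global section of [piK]. *)
have smooth_s := smooth_section mNK smooth_star.
have sK k : piK (piKstar (k, 0)).1 = k by have [] := starP (k, 0).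
have hMN := sR_hamiltonian_pullback nested g_riem g_inv gK_quot smooth_s sK.
have CM : C2ham (sR_hamiltonian DH g).
  exact: (C2ham_sR mM mNH (pb_smooth pbH) g_riem (pb_submersion pbH)).
have CN : C2ham (sR_hamiltonian D gK).
  apply: (C2ham_pullback mNK mM smooth_star _ CM) => z.
  have [z1 z2] := starP z.
  rewrite [piKstar z]surjective_pairing z2 hMN z1; congr sR_hamiltonian.
  exact: surjective_pairing.
have [pm lamE] : piK m = n /\ lam = tmap piK m *m mu.
  by have := starP (n, mu); rewrite mlam.
have := hamiltonian_flow_projection m mu mM mNK (pb_smooth pbK) CM CN hMN.
rewrite -lamE pm => HF.
rewrite /sR_geodesic.
by move: HF; apply: filterS => t E _; exact: E.
Qed.
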